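(* Let $n\ge2$ and $d=n(n-1)/2$. Let $\mathcal{P}$ be the set of probability distributions on $\mathcal{E}_n$ with a density with respect to $\lambda_d$, and for $P\in\mathcal{P}$ with density $f$ let $H(P)=-\int f\log f\,d\lambda_d=-\mathbb{E}_P[\log f]$ be the differential entropy. For $\eta>0$ define $$ m(\eta)=\mathbb{E}_{\operatorname{LKJ}_n(\eta)}[\log\det C]=\sum_{j=0}^{n-1}\psi\Bigl(\eta+\tfrac{j}{2}\Bigr)-n\,\psi\Bigl(\eta+\tfrac{n-1}{2}\Bigr), $$ where $\psi$ is the digamma function (the second equality being part of the assertion). Then: (i) for every $\eta>0$, $\operatorname{LKJ}_n(\eta)$ is the unique maximizer of $H(P)$ over $\{P\in\mathcal{P}:\mathbb{E}_P[\log\det C]=m(\eta)\}$; (ii) $m$ is continuous and strictly increasing on $(0,\infty)$, with $m(\eta)\to-\infty$ as $\eta\to0$ and $m(\eta)\to0$ as $\eta\to\infty$, so every value in $(-\infty,0)$ is attained by exactly one $\eta$; (iii) the uniform distribution on $\mathcal{E}_n$, i.e. $\operatorname{LKJ}_n(1)$, is the unique maximizer of $H(P)$ over all of $\mathcal{P}$, with no constraint imposed.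
   Context: $\mathcal{E}_n=\{C\in\mathbb{R}^{n\times n}:C=C^\prime,\ C\succeq0,\ C_{ii}=1\}$ is the set of $n\times n$ correlation matrices (the elliptope), identified through its $d=n(n-1)/2$ free off-diagonal entries $\{C_{ij}:i<j\}$ with a subset of $[-1,1]^d$. $\lambda_d$ denotes Lebesgue measure in these off-diagonal coordinates; all densities and entropies are relative to $\lambda_d$. For $\eta>0$, $\operatorname{LKJ}_n(\eta)$ is the distribution on $\mathcal{E}_n$ with density $Z_n(\eta)^{-1}\det(C)^{\eta-1}$ with respect to $\lambda_d$, where $Z_n(\eta)=\int_{\mathcal{E}_n}\det(C)^{\eta-1}d\lambda_d$. *)

(* Defs.v *)
From HB Require Import structures.
From mathcomp Require Import all_boot all_order all_algebra.
From mathcomp Require Import all_classical all_reals all_analysis.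
From mathcomp Require Import measurable_realfun.

Set Implicit Arguments.
Unset Strict Implicit.
Unset Printing Implicit Defensive.

Import Order.TTheory GRing.Theory Num.Theory.
Import numFieldNormedType.Exports.

Local Open Scope classical_set_scope.
Local Open Scope ring_scope.

Notation Rtuple R d := (d.-tuple (measurableTypeR R)).

Section lebesgue_cons.
Variables (R : realType) (d : nat).

Definition consp (x : measurableTypeR R * Rtuple R d) : Rtuple R d.+1 :=
  [tuple of x.1 :: x.2].

Lemma measurable_consp : measurable_fun [set: _] consp.
Proof. exact: measurable_cons. Qed.

Definition unconsp (x : Rtuple R d.+1) : measurableTypeR R * Rtuple R d :=
  (thead x, [tuple of behead x]).

Lemma measurable_unconsp : measurable_fun [set: _] unconsp.
Proof.
apply/measurable_fun_pairP; split.
  exact: (measurable_tnth ord0).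
exact: measurable_behead.
Qed.

Lemma conspK : cancel consp unconsp.
Proof. by move=> [a t]; congr pair; exact: val_inj. Qed.

Lemma unconspK : cancel unconsp consp.
Proof. by move=> x; rewrite [RHS]tuple_eta; exact: val_inj. Qed.

Variable mu : {sigma_finite_measure set (Rtuple R d) -> \bar R}.

Definition lebesgue_cons : set (Rtuple R d.+1) -> \bar R :=
  pushforward (@lebesgue_measure R \x mu)%E consp.

Let lebesgue_cons0 : lebesgue_cons set0 = 0%E.
Proof. by rewrite /lebesgue_cons /pushforward preimage_set0 measure0. Qed.

Let lebesgue_cons_ge0 A : (0 <= lebesgue_cons A)%E.
Proof. by rewrite /lebesgue_cons /pushforward; exact: measure_ge0. Qed.

Let lebesgue_cons_sigma_additive : semi_sigma_additive lebesgue_cons.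
Proof.
move=> F mF tF mUF; rewrite /lebesgue_cons /pushforward preimage_bigcup.
apply: measure_semi_sigma_additive.
- by move=> n; rewrite -[X in measurable X]setTI; exact: measurable_consp.
- apply/trivIsetP => /= i j _ _ ij; rewrite -preimage_setI.
  by move/trivIsetP : tF => /(_ _ _ _ _ ij) ->//; rewrite preimage_set0.
- rewrite -preimage_bigcup -[X in measurable X]setTI.
  exact: measurable_consp.
Qed.

HB.instance Definition _ := isMeasure.Build _ _ _ lebesgue_cons
  lebesgue_cons0 lebesgue_cons_ge0 lebesgue_cons_sigma_additive.

Let lebesgue_cons_sigma_finite : sigma_finite setT lebesgue_cons.
Proof.
have /sigma_finiteP[F [FT ndF Foo]] := sigma_finiteT (@lebesgue_measure R).
have /sigma_finiteP[G [GT ndG Goo]] := sigma_finiteT mu.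
exists (fun k => unconsp @^-1` (F k `*` G k)).
  rewrite -preimage_bigcup (_ : \bigcup_k _ = setT) ?preimage_setT//.
  apply/seteqP; split => // -[x y] _.
  have [i _ Fix] : (\bigcup_k F k) x by rewrite -FT.
  have [j _ Gjy] : (\bigcup_k G k) y by rewrite -GT.
  exists (maxn i j) => //; split.
  - by move: x Fix; exact/subsetPset/ndF/leq_maxl.
  - by move: y Gjy; exact/subsetPset/ndG/leq_maxr.
move=> k; have [mF Fk] := Foo k; have [mG Gk] := Goo k; split.
  by rewrite -[_ @^-1` _]setTI; apply: measurable_unconsp => //;
    exact: measurableX.
rewrite /lebesgue_cons /pushforward -comp_preimage.
rewrite (_ : unconsp \o consp = id); last first.
  by apply/funext => x /=; exact: conspK.
by rewrite preimage_id product_measure1E// lte_mul_pinfty// ge0_fin_numE.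
Qed.

HB.instance Definition _ := Measure_isSigmaFinite.Build _ _ _ lebesgue_cons
  lebesgue_cons_sigma_finite.
End lebesgue_cons.

(* d-dimensional Lebesgue measure on the Borel sets of R^d; lebesgue_tuple_box
   below computes it on boxes. *)
Fixpoint lebesgue_tuple (R : realType) (d : nat) :
    {sigma_finite_measure set (Rtuple R d) -> \bar R} :=
  match d with
  | 0 => \d_ ([tuple] : Rtuple R 0)
  | d'.+1 => lebesgue_cons (lebesgue_tuple R d')
  end.

Lemma lebesgue_tuple_box (R : realType) (d : nat)
    (A : 'I_d -> set (measurableTypeR R)) : (forall i, measurable (A i)) ->
  lebesgue_tuple R d [set x | forall i, A i (tnth x i)] =
  (\prod_(i < d) lebesgue_measure (A i))%E.
Proof.
elim: d A => [A _|d ih A mA].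
  rewrite big_ord0 /= diracE mem_set// => -[//].
rewrite big_ord_recl/= -(ih (fun i => A (lift ord0 i)))//.
rewrite -product_measure1E//; last first.
  rewrite (_ : [set x | _] = \bigcap_(i in [set: 'I_d])
      ((fun x : Rtuple R d => tnth x i) @^-1` A (lift ord0 i))); last first.
    by apply/seteqP; split=> x /= + i => /(_ i); [|move=> /(_ I)].
  apply: fin_bigcap_measurable => // i _; rewrite -[X in measurable X]setTI.
  by apply: measurable_tnth.
rewrite /lebesgue_cons /pushforward; congr product_measure1.
apply/seteqP; split => [[a x] /= Aax|[a x] /= [Aa Ax] i].
  split; first by have := Aax ord0.
  by move=> i; have := Aax (lift ord0 i); rewrite tnthS.
by have [j ->|->//] := unliftP ord0 i; rewrite tnthS.
Qed.

Definition offdiag_dim (n : nat) : nat := (n * n.-1)./2.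

Definition offdiag_idx (n : nat) : seq ('I_n * 'I_n) :=
  [seq p : 'I_n * 'I_n <- enum {: 'I_n * 'I_n} | (p.1 < p.2)%N].

Lemma size_offdiag_idx n : size (offdiag_idx n) = offdiag_dim n.
Proof.
rewrite /offdiag_dim -bin2 -sum1_size big_filter big_enum_cond/=.
rewrite (eq_bigl (fun p : 'I_n * 'I_n => (p.1 < p.2)%N)); last first.
  by move=> p.
rewrite -(pair_big_dep xpredT (fun i j : 'I_n => (i < j)%N) (fun _ _ => 1%N))/=.
rewrite (exchange_big_dep xpredT)//=.
rewrite -bin2_sum big_mkord; apply: eq_bigr => j _.
rewrite sum1_card.
have jn := ltnW (ltn_ord j).
rewrite -[RHS]card_ord.
rewrite -(card_codom (f := widen_ord jn)); last first.
  by move=> a b /(congr1 val)/= ab; exact: val_inj.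
apply: eq_card => i; apply/idP/idP => [ij|/codomP[k ->]].
  by apply/codomP; exists (Ordinal ij); exact: val_inj.
exact: (ltn_ord k).
Qed.

Section elliptope.
Variables (R : realType) (n : nat).
Notation T := (Rtuple R (offdiag_dim n)).
Notation lambda := (lebesgue_tuple R (offdiag_dim n)).

Definition elliptope : set 'M[R]_n :=
  [set C | [/\ C^T = C,
               forall v : 'rV[R]_n, 0 <= (v *m C *m v^T) 0 0
             & forall i, C i i = 1]].

Definition offdiag (C : 'M[R]_n) : T :=
  Tuple (introT eqP (etrans (size_map (fun p => C p.1 p.2) _)
    (size_offdiag_idx n))).

Definition elliptope_coord : set T := offdiag @` elliptope.

(* Inverse of the coordinate map [offdiag] on [elliptope], see [offdiagK]. *)
Definition corr_mx (x : T) : 'M[R]_n :=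
  \matrix_(i, j) if i == j then 1
    else nth 0 x (index (if (i < j)%N then (i, j) else (j, i)) (offdiag_idx n)).

Let mem_offdiag_idx (i j : 'I_n) : (i < j)%N -> (i, j) \in offdiag_idx n.
Proof. by move=> ij; rewrite mem_filter ij mem_enum. Qed.

Lemma corr_mxK : cancel corr_mx offdiag.
Proof.
move=> x; apply: val_inj => /=; apply: (@eq_from_nth _ 0).
  by rewrite size_map size_tuple size_offdiag_idx.
move=> k; rewrite size_map => kn.
case E : (offdiag_idx n) => [|p0 s]; first by rewrite E in kn.
rewrite -E.
rewrite (nth_map p0)//; set p := nth _ _ _.
have pP : p \in offdiag_idx n by exact: mem_nth.
have p12 : (p.1 < p.2)%N by move: pP; rewrite mem_filter => /andP[].
rewrite mxE p12 -surjective_pairing ifF; last first.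
  by apply/negbTE/eqP => p1; rewrite p1 ltnn in p12.
by rewrite index_uniq// filter_uniq// enum_uniq.
Qed.

Lemma offdiagK : {in elliptope, cancel offdiag corr_mx}.
Proof.
move=> C /[!inE] -[CT _ C1]; apply/matrixP => i j; rewrite mxE.
have [->|ij] := eqVneq i j; first by rewrite C1.
have Cij (a b : 'I_n) : (a < b)%N ->
    nth 0 (offdiag C) (index (a, b) (offdiag_idx n)) = C a b.
  move=> /mem_offdiag_idx ab.
  by rewrite (nth_map (a, b)) ?index_mem// nth_index.
case: ltnP => [ltij|leji]; first exact: Cij.
rewrite Cij; first by rewrite -[in RHS]CT mxE.
by rewrite ltn_neqAle leji andbT; apply: contraNneq ij => /val_inj ->.
Qed.

Lemma elliptope_coordE : elliptope_coord = [set x | elliptope (corr_mx x)].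
Proof.
apply/seteqP; split => [_ [C CE <-]/=|x /= xE].
  by rewrite offdiagK// inE.
by exists (corr_mx x) => //; rewrite corr_mxK.
Qed.

Lemma measurable_corr_mx i j :
  measurable_fun [set: T] (fun x => corr_mx x i j : R).
Proof.
rewrite (_ : (fun x => _) = fun x : T => if i == j then 1 : R
  else nth 0 x (index (if (i < j)%N then (i, j) else (j, i)) (offdiag_idx n)));
  last by apply/funext => x; rewrite mxE.
case: (i == j) => //; set k := index _ _.
have [kn|kn] := ltnP k (offdiag_dim n).
  rewrite (_ : (fun x => _) = fun x : T => tnth x (Ordinal kn)).
    exact: (@measurable_tnth _ (measurableTypeR R) _ (Ordinal kn)).
  by apply/funext => x; rewrite [RHS](tnth_nth (0 : R)).
rewrite (_ : (fun x => _) = cst 0)//.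
by apply/funext => x; rewrite nth_default// size_tuple.
Qed.

Lemma measurable_det_corr_mx :
  measurable_fun [set: T] (fun x => \det (corr_mx x) : R).
Proof.
rewrite /determinant; apply: measurable_sum => s.
apply: measurable_funM => //; apply: measurable_prod => i _.
exact: measurable_corr_mx.
Qed.

Let qform (C : 'M[R]_n) (v : 'rV[R]_n) : R :=
  \sum_j (\sum_i v 0 i * C i j) * v 0 j.

Let qformE C v : (v *m C *m v^T) 0 0 = qform C v.
Proof. by rewrite mxE; apply: eq_bigr => j _; rewrite !mxE. Qed.

Let cvg_floor_div (a : R) :
  (fun k : nat => (Num.floor (k.+1%:R * a))%:~R / k.+1%:R : R) @ \oo --> a.
Proof.
apply: (@squeeze_cvgr _ _ _ _ (fun k => a - harmonic k) (fun=> a)).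
- near=> k.
  have k0 : (0 : R) < k.+1%:R by [].
  have /andP[lef ltf] := Num.Theory.floor_itv (k.+1%:R * a).
  rewrite ler_pdivrMr// [a * _]mulrC lef andbT /harmonic ler_pdivlMr//.
  rewrite mulrBl mulVf// lerBlDr [a * _]mulrC.
  by rewrite intrD in ltf; exact: ltW.
- by rewrite -[X in _ --> X]subr0; apply: cvgB; [exact: cvg_cst|exact: cvg_harmonic].
- exact: cvg_cst.
Unshelve. all: by end_near. Qed.

Let cvg_sumR (I : Type) (r : seq I) (f : I -> nat -> R) (l : I -> R) :
  (forall i, f i @ \oo --> l i) ->
  (fun k => \sum_(i <- r) f i k) @ \oo --> \sum_(i <- r) l i.
Proof.
move=> fl; apply: cvg_big => //; exact: add_continuous.
Qed.

Let psd_int (C : 'M[R]_n) :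
  (forall v : 'rV[int]_n, 0 <= qform C (map_mx intr v)) ->
  forall v : 'rV[R]_n, 0 <= qform C v.
Proof.
move=> C0 v.
pose w k : 'rV[R]_n :=
  \row_j ((Num.floor (k.+1%:R * v 0 j))%:~R / k.+1%:R).
have wv j : (fun k => w k 0 j : R) @ \oo --> v 0 j.
  rewrite (_ : (fun k => _) =
    (fun k => (Num.floor (k.+1%:R * v 0 j))%:~R / k.+1%:R)).
    exact: cvg_floor_div.
  by apply/funext => k; rewrite mxE.
have : (fun k => qform C (w k)) @ \oo --> qform C v.
  apply: cvg_sumR => j; apply: cvgM => //.
  by apply: cvg_sumR => i; apply: cvgM => //; exact: cvg_cst.
move=> qw; rewrite -(cvg_lim _ qw)//; apply: limr_ge.
  by apply/cvg_ex; eexists; exact: qw.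
near=> k.
pose z : 'rV[int]_n := \row_j Num.floor (k.+1%:R * v 0 j).
rewrite (_ : qform C (w k) = qform C (map_mx intr z) * (k.+1%:R ^- 2)).
  by rewrite mulr_ge0// invr_ge0 exprn_ge0.
rewrite /qform big_distrl/=; apply: eq_bigr => j _; rewrite !mxE.
rewrite expr2 invfM mulrACA; congr (_ * _).
rewrite big_distrl/=; apply: eq_bigr => i _; rewrite !mxE.
by rewrite mulrAC.
Unshelve. all: by end_near. Qed.

Lemma measurable_elliptope_coord : measurable elliptope_coord.
Proof.
rewrite elliptope_coordE.
rewrite (_ : [set x | _] = \bigcap_k
    (if unpickle k is Some v then
      [set x : T | 0 <= qform (corr_mx x) (map_mx intr (v : 'rV[int]_n))]
     else setT)); last first.
  apply/seteqP; split => [x [_ x0 _] k _|x /= xk].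
    by case: unpickle => //= v; rewrite -qformE; exact: x0.
  have x0 (v : 'rV[int]_n) : 0 <= qform (corr_mx x) (map_mx intr v).
    by have := xk (pickle v) I; rewrite pickleK.
  split.
  - apply/matrixP => i j; rewrite !mxE eq_sym; have [//|ij] := eqVneq i j.
    case: ltngtP => // ji.
    by move/val_inj : ji => ji; rewrite ji eqxx in ij.
  - by move=> v; rewrite qformE; apply: psd_int => {}v; exact: x0.
  - by move=> i; rewrite mxE eqxx.
apply: bigcapT_measurable => k; case: unpickle => // v; rewrite -[X in measurable X]setTI.
apply: measurable_fun_le => //.
apply: measurable_sum => j; apply: measurable_funM => //.
apply: measurable_sum => i; apply: measurable_funM => //.
exact: measurable_corr_mx.
Qed.
End elliptope.

Section densities.
Variables (R : realType) (n : nat).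
Notation T := (Rtuple R (offdiag_dim n)).
Notation lambda := (lebesgue_tuple R (offdiag_dim n)).
Notation E := (@elliptope_coord R n).

Definition is_density (P : probability T R) (f : T -> R) : Prop :=
  [/\ measurable_fun [set: T] f, forall x, 0 <= f x &
      forall A : set T, measurable A -> P A = (\int[lambda]_(x in A) (f x)%:E)%E].

(* A distribution on the elliptope is a Borel probability on R^d that gives
   mass 1 to [elliptope_coord]. *)
Definition elliptope_probs : set (probability T R) :=
  [set P : probability T R | P E = 1%E /\ exists f, is_density P f].

(* Some density of P: it is determined up to a lambda-null set. *)
Definition density (P : probability T R) : T -> R :=
  xget (fun=> 0) [set f | is_density P f].

(* The convention 0 * log 0 = 0 is automatic since [ln 0 = 0]. *)
Definition entropy (P : probability T R) : \bar R :=
  (- \int[lambda]_(x in E) (density P x * ln (density P x))%:E)%E.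

(* The library has [ln 0 = 0] and, for p != 0, [0 `^ p = 0]; both values are
   immaterial, as [\det C = 0] only on a lambda-null set when n >= 2. *)
Definition logdet (x : T) : R := ln (\det (corr_mx x)).

Definition lkj_weight (eta : R) (A : set T) : \bar R :=
  (\int[lambda]_(x in A `&` E) (\det (corr_mx x) `^ (eta - 1))%:E)%E.

Definition lkj_Z (eta : R) : \bar R :=
  (\int[lambda]_(x in E) (\det (corr_mx x) `^ (eta - 1))%:E)%E.

Definition lkj_density (eta : R) (x : T) : R :=
  (fine (lkj_Z eta))^-1 * (\det (corr_mx x) `^ (eta - 1)) * \1_E x.

Section lkj_weight_measure.
Variable eta : R.

Let lkj_weight0 : lkj_weight eta set0 = 0%E.
Proof. by rewrite /lkj_weight set0I integral_set0. Qed.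

Let lkj_weight_ge0 A : (0 <= lkj_weight eta A)%E.
Proof. by apply: integral_ge0 => x _; rewrite lee_fin powR_ge0. Qed.

Let lkj_weight_sigma_additive : semi_sigma_additive (lkj_weight eta).
Proof.
move=> F mF tF mUF; rewrite /lkj_weight setI_bigcupl ge0_integral_bigcup//=.
- apply: is_cvg_ereal_nneg_natsum_cond => k _ _.
  exact: lkj_weight_ge0.
- by move=> k; apply: measurableI => //; exact: measurable_elliptope_coord.
- apply: measurable_funTS; apply/measurable_EFinP.
  apply: (measurableT_comp (measurable_powR (eta - 1))).
  exact: measurable_det_corr_mx.
- by move=> x _; rewrite lee_fin powR_ge0.
- exact: trivIset_setIr.
Qed.

HB.instance Definition _ := isMeasure.Build _ _ _ (lkj_weight eta)
  lkj_weight0 lkj_weight_ge0 lkj_weight_sigma_additive.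
End lkj_weight_measure.

(* [mnormalize] divides by the total mass [lkj_Z eta]; its second argument is
   a fallback used only when that mass is 0 or +oo. *)
Definition LKJ (eta : R) : probability T R :=
  mnormalize (lkj_weight eta) (dirac point).

Definition mean_logdet (eta : R) : R := fine 'E_(LKJ eta)[logdet].

Definition uniform_elliptope (A : set T) : \bar R :=
  (lambda (A `&` E) * (fine (lambda E))^-1%:E)%E.

(* Measures are set functions on all subsets, meaningful on measurable sets
   only, whence the form of the uniqueness clause. *)
Definition unique_maximizer (H : probability T R -> \bar R)
    (S : set (probability T R)) (P0 : probability T R) : Prop :=
  [/\ S P0, forall P, S P -> (H P <= H P0)%E &
      forall P, S P -> (forall Q, S Q -> (H Q <= H P)%E) ->
        forall A, measurable A -> P A = P0 A].
End densities.

Section digamma.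
Variable R : realType.

Definition Gamma (x : R) : R :=
  \int[lebesgue_measure]_(t in `]0, +oo[) (t `^ (x - 1) * expR (- t)).

Definition digamma (x : R) : R := Gamma^`()%classic x / Gamma x.
End digamma.

(* Main.v *)
Require Import Defs.
From HB Require Import structures.
From mathcomp Require Import all_boot all_order all_algebra.
From mathcomp Require Import all_classical all_reals all_analysis.
From mathcomp Require Import measurable_realfun.
From mathcomp Require Import ring lra.

(** Two facts carry the proof.

    The first is the Gibbs inequality. Let [f] be the density of a distribution
    [Q] on the elliptope and [g] that of [LKJ n eta]. Integrating
    [f * ln g + (f - g) <= f * ln f] bounds the entropy of [Q] by minus the mean
    of [ln g] under [Q], with equality only if [f = g] almost everywhere. As
    [ln g] is [(eta - 1) * logdet] plus a constant, this bound is the same for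
    all [Q] with a given mean of [(eta - 1) * logdet], and [LKJ n eta] attains
    it ([unique_maximizer_LKJ]). This gives (i), and also (iii), because at
    [eta = 1] the constraint is void.

    The second is a closed form of the normalizing constant
    ([lkj_integralS], [lkj_ZE]). Remove the first row [u] of a correlation matrix
    and let [C] be the remaining minor. The matrix is positive definite if and
    only if [C] is and [u C^-1 u^T < 1], and its determinant is
    [\det C * (1 - u C^-1 u^T)]. Integrating over [u] by the substitution that
    maps the ellipsoid to the unit ball ([ge0_integral_quad]) reduces the
    constant for size [n.+1] at [s] to the one for size [n] at [s + 1/2], times
    the integral of [(1 - |u|^2) `^ (s - 1)] over the unit ball of [R^n]. The
    latter is a quotient of gamma values ([ball_integralE]). The same
    decomposition shows that the singular matrices form a null set
    ([elliptope_boundary_null]), so that everything can be computed on the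
    positive definite ones.

    The mean of [logdet] is the logarithmic derivative of the normalizing
    constant. Both the constant, as a function of [eta], and the gamma function
    are Laplace transforms [s |-> \int expR (s * h x) * v x], which may be
    differentiated under the integral sign and whose logarithmic derivative is
    nondecreasing, and constant as soon as it takes a value twice
    ([is_derive_laplace], [laplace_logderiv_le], [laplace_logderiv_eq]). The
    closed form then gives the digamma formula for [m]. The monotonicity of the
    digamma function and its recurrence give the limits of [m] at [0] and at
    infinity; [m] is strictly increasing since it is nondecreasing and not
    constant, and continuous as a quotient of differentiable functions. The
    intermediate value theorem concludes (ii). *)

Set Implicit Arguments.
Unset Strict Implicit.
Unset Printing Implicit Defensive.

Import Order.TTheory GRing.Theory Num.Theory.
Import numFieldNormedType.Exports.

Local Open Scope classical_set_scope.
Local Open Scope ring_scope.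

(** * Affine substitution and iterated integrals over tuples *)

Section one_dimensional_substitution.
Variable R : realType.
Local Open Scope ereal_scope.

(** Lebesgue measure and [a] times its image under [x |-> a * x + b] agree on
    intervals, hence on all Borel sets. *)
Lemma ge0_integral_affine (a b : R) (f : measurableTypeR R -> \bar R) :
    (0 < a)%R -> measurable_fun setT f -> (forall x, 0 <= f x) ->
  \int[lebesgue_measure]_x f (a * x + b)%R =
  a^-1%:E * \int[lebesgue_measure]_x f x.
Proof.
move=> a0 mf f0.
pose phi := (fun x : measurableTypeR R => (a * x + b)%R : measurableTypeR R).
have mphi : measurable_fun setT phi.
  by apply: measurable_funD => //; apply: measurable_funM.
pose k : {nonneg R} := NngNum (ltW a0).
have E1 A : measurable A -> lebesgue_measure A =
    mscale k (pushforward lebesgue_measure phi) A.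
  apply: lebesgue_measure_unique => _ [[u v] _ <-].
  have E : phi @^-1` [set` `]u, v]%R] = [set` `](u - b) / a, (v - b) / a]%R].
    apply/seteqP; split=> x /=; rewrite !in_itv/= /phi
      ltr_pdivrMr// ler_pdivlMr// ltrBlDr lerBrDr [(x * a)%R]mulrC//.
  rewrite [RHS](_ : _ = a%:E * lebesgue_measure (phi @^-1` [set` `]u, v]%R]))//.
  rewrite E !lebesgue_measure_itv/= !lte_fin ltr_pM2r ?invr_gt0// ltrD2r.
  case: ifP => uv; last by rewrite mule0.
  rewrite -!EFinD -EFinM; congr EFin.
  by field; rewrite gt_eqF.
have H : \int[lebesgue_measure]_x f x =
    a%:E * \int[lebesgue_measure]_x f (phi x).
  rewrite (eq_measure_integral (mscale k (pushforward lebesgue_measure phi)));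
    last by move=> A mA _; exact: E1.
  rewrite ge0_integral_mscale//=; congr (_ * _).
  by rewrite ge0_integral_pushforward// => x _; exact: f0.
by rewrite H muleA -EFinM mulVf ?mul1e// gt_eqF.
Qed.

End one_dimensional_substitution.

Section tuple_integral.
Variable R : realType.
Local Open Scope ereal_scope.

Lemma ge0_integral_tuple0 (f : Rtuple R 0 -> \bar R) :
  \int[lebesgue_tuple R 0]_x f x = f [tuple].
Proof.
rewrite /= integral_dirac ?diracE ?mem_set ?mul1e//.
move=> _ Y mY; rewrite setTI.
have [E|E] := pselect (Y (f [tuple])).
  rewrite (_ : _ @^-1` _ = setT)//; apply/seteqP; split=> // x _.
  by rewrite /= tuple0.
rewrite (_ : _ @^-1` _ = set0)//; apply/seteqP; split=> // x.
by rewrite /= tuple0.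
Qed.

Lemma ge0_integral_tuple_cons d (f : Rtuple R d.+1 -> \bar R) :
    measurable_fun setT f -> (forall x, 0 <= f x) ->
  \int[lebesgue_tuple R d.+1]_x f x =
  \int[lebesgue_measure]_a \int[lebesgue_tuple R d]_x f [tuple of a :: x].
Proof.
move=> mf f0 /=.
rewrite /lebesgue_cons ge0_integral_pushforward//; last exact: measurable_consp.
rewrite preimage_setT fubini_tonelli1// => [|x]; last exact: f0.
by apply: measurableT_comp => //; exact: measurable_consp.
Qed.

Lemma measurable_tuple_cat k m d (e : (k + m)%N = d) :
  measurable_fun setT (fun z : Rtuple R k * Rtuple R m =>
    tcast e [tuple of z.1 ++ z.2] : Rtuple R d).
Proof.
subst d; apply/measurable_fun_tnthP => i.
have [j ij|j ij] := split_ordP i; rewrite ij.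
- rewrite (_ : _ \o _ = (fun z => tnth z.1 j)).
    by apply: (measurableT_comp (measurable_tnth j)); exact: measurable_fst.
  by apply/funext => z /=; rewrite tnth_lshift.
- rewrite (_ : _ \o _ = (fun z => tnth z.2 j)).
    by apply: (measurableT_comp (measurable_tnth j)); exact: measurable_snd.
  by apply/funext => z /=; rewrite tnth_rshift.
Qed.

(** The dimension [d] is only provably equal to [k + m]: this is the form needed
    for the coordinates of a correlation matrix, where a row of length [n] is
    followed by the coordinates of a matrix of size [n]. *)
Lemma ge0_integral_tuple_cat k m d (e : (k + m)%N = d)
    (f : Rtuple R d -> \bar R) :
    measurable_fun setT f -> (forall x, 0 <= f x) ->
  \int[lebesgue_tuple R d]_x f x =
  \int[lebesgue_tuple R k]_u \int[lebesgue_tuple R m]_x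
    f (tcast e [tuple of u ++ x]).
Proof.
subst d => mf f0; rewrite /tcast/=.
elim: k f mf f0 => [|k IH] f mf f0.
  rewrite ge0_integral_tuple0; apply: eq_integral => x _; congr f.
  exact: val_inj.
rewrite [LHS](@ge0_integral_tuple_cons (k + m)%N f mf f0).
rewrite ge0_integral_tuple_cons//; last 2 first.
- apply: (measurable_fun_fubini_tonelli_F
    (fun z : Rtuple R k.+1 * Rtuple R m => f [tuple of z.1 ++ z.2])) => //.
  apply: measurableT_comp => //.
  exact: (measurable_tuple_cat (erefl (k.+1 + m)%N)).
- by move=> u; apply: integral_ge0.
apply: eq_integral => a _.
have mcons : measurable_fun setT
    (fun x : Rtuple R (k + m) => [tuple of a :: x] : Rtuple R (k + m).+1).
  exact: (measurable_cons (f := fun=> a) (g := id)).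
rewrite (IH _ (measurableT_comp mf mcons) (fun x => f0 _)).
apply: eq_integral => u _; apply: eq_integral => x _.
by congr f; exact: val_inj.
Qed.

End tuple_integral.

(** * Positive definite matrices and integrals of functions of a quadratic form *)

Section positive_definite.
Variable R : realType.

Definition posdef k (A : 'M[R]_k) : Prop :=
  A^T = A /\ forall v : 'rV[R]_k, v != 0 -> 0 < (v *m A *m v^T) 0 0.

Lemma quad_block k (a s : R) (b y : 'rV[R]_k) (D : 'M[R]_k) :
  (row_mx s%:M y *m block_mx a%:M b b^T D *m (row_mx s%:M y)^T) 0 0 =
  a * s ^+ 2 + 2 * s * (b *m y^T) 0 0 + (y *m D *m y^T) 0 0.
Proof.
rewrite mul_row_block tr_row_mx mul_row_col tr_scalar_mx !mulmxDl.
have -> : y *m b^T = (b *m y^T)^T by rewrite trmx_mul trmxK.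
rewrite -(mulmxA s%:M b) [b *m y^T]mx11_scalar [y *m D *m y^T]mx11_scalar.
set p := (b *m y^T) 0 0; set q := (y *m D *m y^T) 0 0.
rewrite tr_scalar_mx -!scalar_mxM -!raddfD/= !mxE eqxx !mulr1n.
ring.
Qed.

Definition schur k (a : R) (b : 'rV[R]_k) (D : 'M[R]_k) : 'M[R]_k :=
  D - a^-1 *: (b^T *m b).

(** Completing the square in the first coordinate. *)
Lemma quad_schur k (a s : R) (b y : 'rV[R]_k) (D : 'M[R]_k) : a != 0 ->
  (row_mx s%:M y *m block_mx a%:M b b^T D *m (row_mx s%:M y)^T) 0 0 =
  a * (s + (b *m y^T) 0 0 / a) ^+ 2 + (y *m schur a b D *m y^T) 0 0.
Proof.
move=> a0; rewrite quad_block /schur mulmxBr mulmxBl.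
set p := (b *m y^T) 0 0.
have -> : y *m (a^-1 *: (b^T *m b)) *m y^T = (a^-1 * p ^+ 2)%:M.
  rewrite -scalemxAr -scalemxAl mulmxA -(mulmxA (y *m b^T)).
  have -> : y *m b^T = (b *m y^T)^T by rewrite trmx_mul trmxK.
  have -> : b *m y^T = p%:M by exact: mx11_scalar.
  by rewrite tr_scalar_mx -scalar_mxM scale_scalar_mx expr2.
have -> : (y *m D *m y^T - (a^-1 * p ^+ 2)%:M) 0 0 =
    (y *m D *m y^T) 0 0 - a^-1 * p ^+ 2.
  by rewrite [LHS]mxE [X in _ + X]mxE [X in - X]mxE eqxx mulr1n.
by field.
Qed.

Lemma det_schur k (a : R) (b : 'rV[R]_k) (D : 'M[R]_k) : a != 0 ->
  \det (block_mx a%:M b b^T D) = a * \det (schur a b D).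
Proof.
move=> a0.
have -> : block_mx a%:M b b^T D =
    block_mx 1%:M 0 (a^-1 *: b^T) 1%:M *m block_mx a%:M b 0 (schur a b D).
  rewrite mulmx_block !mul1mx !mul0mx !addr0.
  rewrite mul_mx_scalar scalerA mulfV// scale1r /schur -scalemxAl.
  by rewrite addrC subrK.
by rewrite det_mulmx det_lblock det_ublock !det1 !mul1r det_scalar1.
Qed.

Lemma sym_block k (A : 'M[R]_(1 + k)) : A^T = A ->
  exists a (b : 'rV[R]_k) D, A = block_mx a%:M b b^T D /\ D^T = D.
Proof.
move=> AT; exists (A 0 0), (ursubmx A), (drsubmx A).
split; last by rewrite trmx_drsub AT.
rewrite -[LHS]submxK; congr block_mx.
  rewrite [LHS]mx11_scalar; congr (_ %:M); rewrite !mxE.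
  by congr (A _ _); exact: val_inj.
by rewrite trmx_ursub AT.
Qed.

(** By [quad_schur] the form is [a] times a square plus the form of the Schur
    complement, and for every [y] some [s] makes the square vanish. *)
Lemma posdef_schur k (a : R) (b : 'rV[R]_k) (D : 'M[R]_k) : D^T = D ->
  posdef (block_mx a%:M b b^T D) <-> 0 < a /\ posdef (schur a b D).
Proof.
move=> DT.
have sT : (schur a b D)^T = schur a b D.
  by rewrite /schur linearB linearZ/= trmx_mul trmxK DT.
split=> [[_ A0]|[a0 [_ S0]]].
  have a0 : 0 < a.
    have /A0 : row_mx 1%:M (0 : 'rV[R]_k) != 0.
      rewrite row_mx_eq0 negb_and; apply/orP; left.
      by apply/eqP => /matrixP/(_ 0 0); rewrite !mxE/= => /eqP; rewrite oner_eq0.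
    rewrite quad_block trmx0 mulmx0 mul0mx mxE mulr0 addr0 mulmx0 mxE addr0.
    by rewrite expr1n mulr1.
  split=> //; split=> // y y0.
  pose s := - ((b *m y^T) 0 0 / a).
  have /A0 : row_mx s%:M y != 0 by rewrite row_mx_eq0 negb_and y0 orbT.
  by rewrite quad_schur ?gt_eqF// /s addNr expr0n mulr0 add0r.
split; first by rewrite tr_block_mx tr_scalar_mx trmxK DT.
move=> v; rewrite -[v]hsubmxK [lsubmx v]mx11_scalar.
set s := lsubmx v 0 0; set y := rsubmx v => v0.
rewrite quad_schur ?gt_eqF//.
have [y0|y0] := eqVneq y 0; last first.
  by rewrite ltr_wpDl ?S0// mulr_ge0 ?sqr_ge0 ?ltW.
move: v0; rewrite y0 trmx0 !mulmx0 !mxE mul0r addr0 addr0 => v0.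
rewrite mulr_gt0// lt0r sqr_ge0 andbT sqrf_eq0.
apply: contra v0 => /eqP ->; rewrite row_mx_eq0 eqxx andbT.
by apply/eqP/matrixP => i j; rewrite !mxE mul0rn.
Qed.

Lemma posdef_det_gt0 k (A : 'M[R]_k) : posdef A -> 0 < \det A.
Proof.
elim: k A => [|k IH] A; first by rewrite det_mx00.
move=> pA; have [AT _] := pA.
have [a [b [D [E DT]]]] := @sym_block k A AT.
move: pA; rewrite E => /(posdef_schur _ _ DT)[a0 /IH S0].
by rewrite det_schur ?gt_eqF// mulr_gt0.
Qed.

Definition rowt k (u : Rtuple R k) : 'rV[R]_k := \row_i tnth u i.
Definition quad k (A : 'M[R]_k) (u : Rtuple R k) : R :=
  (rowt u *m A *m (rowt u)^T) 0 0.
Definition sqnorm k (u : Rtuple R k) : R := \sum_i tnth u i ^+ 2.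

Lemma rowt_cons k x (u : Rtuple R k) :
  rowt [tuple of x :: u] = row_mx x%:M (rowt u).
Proof.
apply/rowP => i; have [j ij|j ij] := @split_ordP 1 k i; rewrite ij.
  by rewrite [RHS]row_mxEl !mxE (ord1 j) eqxx mulr1n (tnth_nth 0).
by rewrite [RHS]row_mxEr !mxE !(tnth_nth 0).
Qed.

Lemma sqnorm_cons k x (u : Rtuple R k) :
  sqnorm [tuple of x :: u] = x ^+ 2 + sqnorm u.
Proof.
rewrite /sqnorm big_ord_recl; congr (_ + _).
by apply: eq_bigr => i _; rewrite tnthS.
Qed.

Lemma sqnorm_ge0 k (u : Rtuple R k) : 0 <= sqnorm u.
Proof. by apply: sumr_ge0 => i _; rewrite sqr_ge0. Qed.

Lemma measurable_rowt k i :
  measurable_fun setT (fun u : Rtuple R k => rowt u 0 i).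
Proof.
rewrite (_ : (fun _ => _) = (fun u => tnth u i)); first exact: measurable_tnth.
by apply/funext => u; rewrite mxE.
Qed.

Lemma measurable_quad k (A : 'M[R]_k) : measurable_fun setT (quad A).
Proof.
rewrite (_ : quad A = fun u => \sum_j (\sum_i rowt u 0 i * A i j) * rowt u 0 j).
  apply: measurable_sum => j; apply: measurable_funM; last exact: measurable_rowt.
  apply: measurable_sum => i; apply: measurable_funM => //.
  exact: measurable_rowt.
apply/funext => u; rewrite /quad mxE; apply: eq_bigr => j _.
by rewrite !mxE; congr (_ * _).
Qed.

Lemma measurable_sqnorm k : measurable_fun setT (@sqnorm k).
Proof.
apply: measurable_sum => i; apply: measurable_funX.
exact: (@measurable_tnth _ (measurableTypeR R)).
Qed.

End positive_definite.

Section gaussian_substitution.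
Variable R : realType.
Local Open Scope ereal_scope.

(** A linear change of variables that needs no Jacobian: after completing the
    square, the integral over the first coordinate is a one-dimensional affine
    substitution, which contributes [a^(-1/2)], and induction on the dimension
    treats the Schur complement, whose determinant is [\det A / a]. *)
Lemma ge0_integral_quad k (A : 'M[R]_k) (g : measurableTypeR R -> \bar R) :
    posdef A -> measurable_fun setT g -> (forall x, 0 <= g x) ->
  \int[lebesgue_tuple R k]_u g (quad A u) =
  (Num.sqrt (\det A))^-1%:E * \int[lebesgue_tuple R k]_u g (sqnorm u).
Proof.
elim: k A g => [|k IH] A g pA mg g0.
  rewrite !ge0_integral_tuple0 det_mx00 sqrtr1 invr1 mul1e.
  by rewrite /quad /sqnorm big_ord0 mxE big_ord0.
have [AT _] := pA.
have [a [b [D [E DT]]]] := @sym_block _ k A AT.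
move: (pA); rewrite E => /(posdef_schur _ _ DT)[a0 pS].
have d0 := posdef_det_gt0 pS.
rewrite det_schur ?gt_eqF//.
have mgq : measurable_fun setT (g \o quad (block_mx a%:M b b^T D)).
  by apply: measurableT_comp => //; exact: measurable_quad.
rewrite (ge0_integral_tuple_cons mgq (fun x => g0 _)).
pose l (u : Rtuple R k) : R := ((b *m (rowt u)^T) 0 0)%R.
have qE (x : measurableTypeR R) (u : Rtuple R k) :
    quad (block_mx a%:M b b^T D) [tuple of x :: u] =
    ((Num.sqrt a * x + l u / Num.sqrt a) ^+ 2 + quad (schur a b D) u)%R.
  rewrite /quad rowt_cons quad_schur ?gt_eqF//; congr (_ + _)%R.
  rewrite -/(l u) -[in LHS](@sqr_sqrtr _ a) 1?ltW//.
  have sa0 : (Num.sqrt a != 0)%R by rewrite gt_eqF// sqrtr_gt0.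
  by field.
have ml : measurable_fun setT l.
  rewrite (_ : l = fun u => \sum_i b 0 i * rowt u 0 i)%R.
    apply: measurable_sum => i; apply: measurable_funM => //.
    exact: measurable_rowt.
  apply/funext => u; rewrite /l mxE; apply: eq_bigr => i _.
  by rewrite [X in (_ * X)%R]mxE.
pose G (q : Rtuple R k -> R) (z : measurableTypeR R * Rtuple R k) :=
  g (z.1 ^+ 2 + q z.2)%R.
have mG q : measurable_fun setT q -> measurable_fun setT (G q).
  move=> mq; apply: measurableT_comp => //; apply: measurable_funD.
    by apply: measurable_funX; exact: measurable_fst.
  by apply: measurableT_comp => //; exact: measurable_snd.
transitivity (\int[lebesgue_measure]_x \int[lebesgue_tuple R k]_u
    g ((Num.sqrt a * x + l u / Num.sqrt a) ^+ 2 + quad (schur a b D) u)%R).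
  by apply: eq_integral => x _; apply: eq_integral => u _ /=; rewrite qE.
rewrite (fubini_tonelli (fun z : measurableTypeR R * Rtuple R k =>
  g ((Num.sqrt a * z.1 + l z.2 / Num.sqrt a) ^+ 2 + quad (schur a b D) z.2)%R))//;
    last first.
  apply: measurableT_comp => //; apply: measurable_funD.
    apply: measurable_funX; apply: measurable_funD.
      by apply: measurable_funM => //; exact: measurable_fst.
    apply: measurable_funM => //.
    by apply: measurableT_comp => //; exact: measurable_snd.
  by apply: measurableT_comp; [exact: measurable_quad|exact: measurable_snd].
have sa0 : (0 < Num.sqrt a)%R by rewrite sqrtr_gt0.
transitivity (\int[lebesgue_tuple R k]_u ((Num.sqrt a)^-1%:E *
    \int[lebesgue_measure]_x G (quad (schur a b D)) (x, u))).
  apply: eq_integral => u _.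
  pose gu (z : measurableTypeR R) := g (z ^+ 2 + quad (schur a b D) u)%R.
  have mgu : measurable_fun setT gu.
    by apply: measurableT_comp => //; apply: measurable_funD.
  have := ge0_integral_affine (l u / Num.sqrt a) sa0 mgu (fun z => g0 _).
  by [].
have mGq := mG _ (measurable_quad (schur a b D)).
have mGs := mG _ (@measurable_sqnorm _ k).
rewrite ge0_integralZl//; last 2 first.
- have H := @measurable_fun_fubini_tonelli_G _ _ _ _ R
      (@lebesgue_measure R) _ mGq (fun=> g0 _).
  exact: H.
- by move=> u _; apply: integral_ge0 => ? _; exact: g0.
rewrite -(fubini_tonelli (G (quad (schur a b D))))// => [|z]; last exact: g0.
transitivity ((Num.sqrt a)^-1%:E * \int[lebesgue_measure]_x
   ((Num.sqrt (\det (schur a b D)))^-1%:E *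
     \int[lebesgue_tuple R k]_u G (@sqnorm _ k) (x, u))).
  congr (_ * _); apply: eq_integral => x _.
  rewrite (@IH _ (fun z => g (x ^+ 2 + z)%R))//.
  by apply: measurableT_comp => //; exact: measurable_funD.
rewrite ge0_integralZl//; last 2 first.
- have H := @measurable_fun_fubini_tonelli_F _ _ _ _ R
      (lebesgue_tuple R k) _ mGs (fun=> g0 _).
  exact: H.
- by move=> u _; apply: integral_ge0 => ? _; exact: g0.
rewrite muleA -EFinM -invfM -sqrtrM 1?ltW//; congr (_ * _).
have mgs : measurable_fun setT (g \o @sqnorm _ k.+1).
  by apply: measurableT_comp => //; exact: measurable_sqnorm.
rewrite (ge0_integral_tuple_cons mgs (fun x => g0 _)).
by apply: eq_integral => x _; apply: eq_integral => u _ /=; rewrite sqnorm_cons.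
Qed.

End gaussian_substitution.

(** * Laplace transforms and their logarithmic derivatives *)

Lemma ae_eq0_ge0_Rintegral {R : realType} d {T : measurableType d}
    (mu : {measure set T -> \bar R}) (D : set T) (f : T -> R) :
    measurable D -> mu.-integrable D (EFin \o f) ->
    (forall x, D x -> 0 <= f x) -> \int[mu]_(x in D) f x = 0 ->
  ae_eq mu D (EFin \o f) (cst 0%E).
Proof.
move=> mD intf f0 int0; apply/(ae_eq_integral_abs mu mD).
  exact: measurable_int intf.
rewrite (eq_integral (EFin \o f)); last first.
  by move=> x /set_mem Dx /=; rewrite ger0_norm// f0.
have /fineK <- := integrable_fin_num mD intf.
by rewrite -[fine _]/(Rintegral mu D f) int0.
Qed.

(** Below, [fa] and [fb] are the values at [a] and [b] of a positive function,
    and [ma], [mb], [m] are slopes of lines tangent to the graph of its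
    logarithm. *)
Section tangent_slopes.
Context {R : realType} (a b fa fb : R).

Let expR_cancel m : expR (- ((a - b) * m)) * expR (- ((b - a) * m)) = 1.
Proof. by rewrite -expRD (_ : - _ + _ = 0) ?expR0//; ring. Qed.

Lemma tangent_slope_le ma mb : a < b -> 0 < fa ->
  fa <= fb * expR (- ((b - a) * ma)) -> fb <= fa * expR (- ((a - b) * mb)) ->
  ma <= mb.
Proof.
move=> ab fa0 H1 H2.
have : fa <= fa * (expR (- ((a - b) * mb)) * expR (- ((b - a) * ma))).
  by rewrite mulrA (le_trans H1)// ler_wpM2r ?expR_ge0.
rewrite ler_pMr// -expRD -expR0 ler_expR.
rewrite (_ : - _ + _ = (b - a) * (mb - ma)); last by ring.
by rewrite pmulr_rge0 ?subr_gt0// subr_ge0.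
Qed.

Lemma tangent_slope_eq m :
  fa <= fb * expR (- ((b - a) * m)) -> fb <= fa * expR (- ((a - b) * m)) ->
  fb * expR (- ((b - a) * m)) = fa.
Proof.
move=> H1 H2; apply/le_anti; rewrite H1 andbT.
have := ler_wpM2r (expR_ge0 (- ((b - a) * m))) H2 => /le_trans; apply.
by rewrite -mulrA expR_cancel mulr1.
Qed.

End tangent_slopes.

Section laplace_transform.
Context {R : realType} d {T : measurableType d} (mu : {measure set T -> \bar R}).
Variables (D : set T) (mD : measurable D) (h : T -> R).
Hypothesis mh : measurable_fun D h.

(** The factor [v] may change sign, so that the class of these integrals is
    closed under differentiation in [s], which multiplies [v] by [h]. *)
Definition laplace (v : T -> R) (s : R) : R :=
  \int[mu]_(x in D) (expR (s * h x) * v x).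

Definition laplace_integrable (v : T -> R) : Prop := forall s, 0 < s ->
  mu.-integrable D (EFin \o (fun x => expR (s * h x) * v x)).

Lemma le_norm_expR (c y : R) : 0 < c ->
  `|y| <= c^-1 * (expR (c * y) + expR (- (c * y))).
Proof.
move=> c0; rewrite ler_pdivlMl// -[X in X * _](gtr0_norm c0) -normrM.
have [cy|cy] := ger0P (c * y).
- apply: le_trans (_ : expR (c * y) <= _); last by rewrite lerDl expR_ge0.
  by apply: le_trans (expR_ge1Dx _); rewrite lerDr.
- apply: le_trans (_ : expR (- (c * y)) <= _); last by rewrite lerDr expR_ge0.
  by apply: le_trans (expR_ge1Dx _); rewrite lerDr.
Qed.

(** The extra factor [h] only costs a small shift of [s], since [`|h x|] is at
    most a multiple of [expR (s / 2 * h x) + expR (- (s / 2 * h x))]. *)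
Lemma laplace_integrableM (v : T -> R) : measurable_fun D v ->
  laplace_integrable v -> laplace_integrable (fun x => h x * v x).
Proof.
move=> mv iv s s0.
have s20 : 0 < s / 2 by rewrite divr_gt0.
pose g x := (s / 2)^-1 * (expR ((s + s / 2) * h x) * v x +
  expR (s / 2 * h x) * v x).
apply: (@le_integrable _ _ _ _ _ _ _ (EFin \o g)) => //.
- apply/measurable_EFinP; apply: measurable_funM.
    by apply: measurableT_comp => //; apply: measurable_funM.
  exact: measurable_funM.
- move=> x Dx /=; rewrite lee_fin /g -mulrDl !normrM !(gtr0_norm (expR_gt0 _)).
  rewrite !mulrA ler_wpM2r//.
  rewrite (ger0_norm (_ : 0 <= (s / 2)^-1)); last by rewrite invr_ge0 ltW.
  rewrite (ger0_norm (_ : 0 <= expR _ + expR _)); last first.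
    by rewrite addr_ge0 ?expR_ge0.
  have := le_norm_expR (h x) s20.
  move/(ler_wpM2l (expR_ge0 (s * h x))) => /le_trans; apply.
  rewrite mulrCA; apply: ler_wpM2l; first by rewrite invr_ge0 ltW.
  rewrite mulrDr -!expRD.
  by rewrite le_eqVlt; apply/orP; left; apply/eqP; congr (expR _ + expR _); field.
- have i1 : 0 < s + s / 2 by rewrite addr_gt0.
  have := integrableZl mD (s / 2)^-1 (integrableD mD (iv _ i1) (iv _ s20)).
  by apply: eq_integrable => // x _.
Qed.

(** On the interval from [s / 2] to [2 * s] the derivative of the integrand is
    dominated by the sum of its absolute values at the two ends, because an
    exponential is monotone in its exponent. *)
Lemma is_derive_laplace (v : T -> R) (s : R) :
  measurable_fun D v -> laplace_integrable v ->
  0 < s -> is_derive s 1 (laplace v) (laplace (fun x => h x * v x) s).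
Proof.
move=> mv iv s0.
have iw := laplace_integrableM mv iv.
pose f (s : R) x := expR (s * h x) * v x.
have s20 : 0 < s / 2 by rewrite divr_gt0.
have s2 : 0 < 2 * s by rewrite mulr_gt0.
have df (x : R) y : is_derive x 1 (f ^~ y) (h y * v y * expR (x * h y)).
  rewrite /f; apply: is_derive_eq.
  by rewrite /GRing.scale/=; ring.
have d1f (x : R) y : partial1of2 f x y = expR (x * h y) * (h y * v y).
  by rewrite partial1of2E mulrC; apply: derive_val.
pose G x := `|expR (s / 2 * h x) * (h x * v x)| +
  `|expR (2 * s * h x) * (h x * v x)|.
have sI : `](s / 2), (2 * s)[%classic s.
  by rewrite /= in_itv/=; apply/andP; split; lra.
have iG : mu.-integrable D (EFin \o G).
  rewrite /G; rewrite [X in _.-integrable _ X](_ : _ = (fun x =>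
    (`|expR (s / 2 * h x) * (h x * v x)|)%:E +
    (`|expR (2 * s * h x) * (h x * v x)|)%:E)%E)//.
  by apply: integrableD => //; apply: integrable_norm; exact: iw.
have H : h0^-1 *: (laplace v (h0 + s) - laplace v s) @[h0 --> 0^'] -->
    laplace (fun x => h x * v x) s.
  have := @cvg_differentiation_under_integral R d T mu f D mD s (s / 2) (2 * s)
    sI _ _ G _ iG _.
  have -> : laplace (fun x => h x * v x) s = \int[mu]_(x in D) partial1of2 f s x.
    by apply: eq_Rintegral => x _; rewrite d1f.
  apply.
  - move=> x /=; rewrite in_itv/= => /andP[x0 _]; apply: iv.
    exact: lt_trans x0.
  - by move=> x y _ _; have [] := df x y.
  - by move=> y; rewrite addr_ge0.
  - move=> x y /=; rewrite in_itv/= => /andP[x0 x1] _; rewrite d1f /G.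
    rewrite !normrM -mulrDl ler_wpM2r// !(gtr0_norm (expR_gt0 _)).
    have [hy|hy] := lerP 0 (h y).
      apply: le_trans (_ : expR (2 * s * h y) <= _); last by rewrite lerDr expR_ge0.
      by rewrite ler_expR ler_wpM2r// ltW.
    apply: le_trans (_ : expR (s / 2 * h y) <= _); last by rewrite lerDl expR_ge0.
    by rewrite ler_expR ler_wnM2r// ltW.
apply: DeriveDef.
  apply/cvg_ex; exists (laplace (fun x => h x * v x) s).
  by under eq_fun do rewrite scaler1.
rewrite /derive; under eq_fun do rewrite scaler1.
exact/cvg_lim.
Qed.

Section nonnegative_weight.
Variable v : T -> R.
Hypotheses (mv : measurable_fun D v) (v0 : forall x, D x -> 0 <= v x)
  (iv : laplace_integrable v).

Let F := laplace v.
Let F' := laplace (fun x => h x * v x).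

(** This is [expR (a * h x) * v x * (expR y - (1 + y))] for
    [y = (b - a) * (h x - m)], written so that it can be integrated term by
    term. *)
Let gap a b m x := expR (b * h x) * v x * expR (- ((b - a) * m)) -
  (expR (a * h x) * v x * (1 - (b - a) * m) +
   (b - a) * (expR (a * h x) * (h x * v x))).

Let gapE a b m x : gap a b m x = expR (a * h x) * v x *
  (expR ((b - a) * (h x - m)) - (1 + (b - a) * (h x - m))).
Proof.
rewrite /gap [RHS]mulrBr; congr (_ - _); last by ring.
rewrite mulrAC -expRD mulrAC -expRD; congr (expR _ * _); ring.
Qed.

Let gap_ge0 a b m x : D x -> 0 <= gap a b m x.
Proof.
by move=> Dx; rewrite gapE !mulr_ge0 ?expR_ge0 ?v0// subr_ge0 expR_ge1Dx.
Qed.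

Let integrable_gap a b m : 0 < a -> 0 < b ->
  mu.-integrable D (EFin \o gap a b m) /\
  \int[mu]_(x in D) gap a b m x = F b * expR (- ((b - a) * m)) -
    (F a * (1 - (b - a) * m) + (b - a) * F' a).
Proof.
move=> a0 b0.
have ia := iv a0; have ib := iv b0.
have iwa := laplace_integrableM mv iv a0.
have i1 : mu.-integrable D (EFin \o
    (fun x => expR (b * h x) * v x * expR (- ((b - a) * m)))).
  have := integrableZr mD (expR (- ((b - a) * m))) ib.
  by apply: eq_integrable => // x _.
have i2 : mu.-integrable D (EFin \o
    (fun x => expR (a * h x) * v x * (1 - (b - a) * m))).
  have := integrableZr mD (1 - (b - a) * m) ia.
  by apply: eq_integrable => // x _.
have i3 : mu.-integrable D (EFin \o
    (fun x => (b - a) * (expR (a * h x) * (h x * v x)))).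
  have := integrableZl mD (b - a) iwa.
  by apply: eq_integrable => // x _.
have i23 : mu.-integrable D (EFin \o
    (fun x => expR (a * h x) * v x * (1 - (b - a) * m) +
      (b - a) * (expR (a * h x) * (h x * v x)))).
  have := integrableD mD i2 i3.
  by apply: eq_integrable => // x _.
split.
  have := integrableB mD i1 i23.
  by apply: eq_integrable => // x _.
rewrite /gap RintegralB// RintegralD// RintegralZl//.
by rewrite !RintegralZr.
Qed.

(** The graph of [ln F] lies above its tangents: integrate [1 + y <= expR y] at
    [y = (b - a) * (h x - F' a / F a)]. *)
Lemma laplace_tangent a b : 0 < a -> 0 < b -> F a != 0 ->
  F a <= F b * expR (- ((b - a) * (F' a / F a))).
Proof.
move=> a0 b0 Fa0.
have [_ E] := @integrable_gap a b (F' a / F a) a0 b0.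
have := Rintegral_ge0 mu (@gap_ge0 a b (F' a / F a)).
rewrite E subr_ge0; apply: le_trans.
by rewrite le_eqVlt; apply/orP; left; apply/eqP; field.
Qed.

Hypothesis F0 : forall s, 0 < s -> 0 < F s.

Lemma laplace_logderiv_le a b : 0 < a -> a <= b -> F' a / F a <= F' b / F b.
Proof.
move=> a0; rewrite le_eqVlt => /predU1P[->//|ab].
have b0 := lt_trans a0 ab.
have Fa := F0 a0; have Fb := F0 b0.
have H1 := laplace_tangent a0 b0 (lt0r_neq0 Fa).
have H2 := laplace_tangent b0 a0 (lt0r_neq0 Fb).
exact: tangent_slope_le ab Fa H1 H2.
Qed.

(** If [F'/F] takes a value twice then the tangent inequality is an equality,
    so [h] is constant almost everywhere on the support of [v]. *)
Lemma laplace_logderiv_eq a b s : 0 < a -> a < b -> 0 < s ->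
  F' a / F a = F' b / F b -> F' s / F s = F' a / F a.
Proof.
move=> a0 ab s0 Eab.
have b0 := lt_trans a0 ab.
have Fa := F0 a0; have Fb := F0 b0.
have H1 := laplace_tangent a0 b0 (lt0r_neq0 Fa).
have H2 := laplace_tangent b0 a0 (lt0r_neq0 Fb).
rewrite -Eab {Eab} in H2.
have Em : F' a = F' a / F a * F a by rewrite divfK ?gt_eqF.
have Fs := lt0r_neq0 (F0 s0).
have E1 := tangent_slope_eq H1 H2.
set m := F' a / F a in Em E1 *.
have [ig E] := @integrable_gap a b m a0 b0.
have g0 : \int[mu]_(x in D) gap a b m x = 0.
  rewrite E E1 Em; ring.
have gae : ae_eq mu D (EFin \o gap a b m) (cst 0%E).
  exact: (ae_eq0_ge0_Rintegral mD ig (@gap_ge0 a b m) g0).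
have iws := laplace_integrableM mv iv s0.
suff H : F' s = m * F s by rewrite H; exact: (mulfK Fs).
rewrite /F' /F /laplace -(RintegralZl _ mD (iv s0)).
rewrite /Rintegral; congr fine; apply: ae_eq_integral.
- exact: mD.
- exact: measurable_int iws.
- apply: measurable_int (_ : mu.-integrable _ _).
  have := integrableZl mD m (iv s0).
  by apply: eq_integrable => // x _.
apply: filterS gae => x + Dx => /(_ Dx)/= [].
rewrite gapE => /eqP; rewrite !mulf_eq0 expR_eq0/= => /orP[/eqP ->|].
  by rewrite !mulr0.
rewrite subr_eq0 => /eqP Ex; congr (_%:E).
have : (b - a) * (h x - m) = 0.
  by apply/eqP; apply: contraT => /expR_gt1Dx; rewrite Ex ltxx.
move/eqP; rewrite mulf_eq0 subr_eq0 gt_eqF//= subr_eq0 => /eqP ->.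
by ring.
Qed.

End nonnegative_weight.
End laplace_transform.

(** * The gamma function *)

Section gamma_integrand.
Variable R : realType.
Notation leb := (@lebesgue_measure R).

Lemma is_derive_powR (a x : R) : 0 < x ->
  is_derive x 1 (fun t => t `^ a) (a * x `^ (a - 1)).
Proof.
move=> x0; have xI : x \in `]0, +oo[ by rewrite in_itv/= x0.
apply: DeriveDef; first exact: derivable_powR.
by rewrite -derive1E powR_derive1.
Qed.

Lemma continuous_powR (a x : R) : 0 < x -> {for x, continuous (fun t => t `^ a)}.
Proof.
move=> x0; apply: differentiable_continuous; apply/derivable1_diffP.
by have [] := is_derive_powR a x0.
Qed.

Lemma integral_powR_itv (x e : R) : 0 < x -> 0 < e -> e < 1 ->
  (\int[leb]_(t in `[e, 1%R]) (t `^ (x - 1))%:E <= (x^-1)%:E)%E.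
Proof.
move=> x0 e0 e1.
pose F t := x^-1 * t `^ x.
have dF (t : R) : 0 < t -> is_derive t 1 F (t `^ (x - 1)).
  move=> t0; have := is_derive_powR x t0 => H.
  by apply: is_derive_eq; rewrite /GRing.scale/= mulrA mulVf ?mul1r// gt_eqF.
have cF (t : R) : 0 < t -> {for t, continuous F}.
  move=> t0; apply: differentiable_continuous; apply/derivable1_diffP.
  by have [] := dF _ t0.
rewrite (@continuous_FTC2 _ _ F)//.
- rewrite -EFinB lee_fin /F powR1 mulr1 lerBlDr lerDl.
  by rewrite mulr_ge0 ?powR_ge0// invr_ge0 ltW.
- apply: continuous_in_subspaceT => t /set_mem/=; rewrite in_itv/= => /andP[et _].
  by apply: continuous_powR; exact: lt_le_trans et.
- split.
  + move=> t; rewrite in_itv/= => /andP[et _].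
    by have [] := dF _ (lt_trans e0 et).
  + by apply: cvg_at_right_filter; exact: cF.
  + by apply: cvg_at_left_filter; exact: cF.
- move=> t; rewrite in_itv/= => /andP[et _].
  by rewrite derive1E; have [_ ->] := dF _ (lt_trans e0 et).
Qed.

Lemma measurable_powRl (a : R) (D : set R) :
  measurable_fun D (fun t : R => t `^ a).
Proof. by apply: measurable_funTS; exact: measurable_powR. Qed.

Lemma integral_powR_itv0 (x : R) : 0 < x ->
  (\int[leb]_(t in `]0%R, 1%R]) (t `^ (x - 1))%:E <= (x^-1)%:E)%E.
Proof.
move=> x0.
pose F k := `[k.+2%:R^-1 : R, 1]%classic.
have UF : \bigcup_k F k = [set` `]0, 1]].
  apply/seteqP; split=> t /=.
    move=> [k _]; rewrite /F/= !in_itv/= => /andP[kt ->]; rewrite andbT.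
    by apply: lt_le_trans kt; rewrite invr_gt0.
  rewrite in_itv/= => /andP[t0 t1].
  exists (Num.truncn t^-1) => //; rewrite /F/= in_itv/= t1 andbT.
  rewrite -[leRHS]invrK lef_pV2 ?posrE ?invr_gt0//.
  have := truncnS_gt t^-1; move/ltW/le_trans; apply.
  by rewrite ler_nat.
rewrite -UF.
have cvgF : (\int[leb]_(t in F k) (t `^ (x - 1))%:E @[k --> \oo] -->
    \int[leb]_(t in \bigcup_k F k) (t `^ (x - 1))%:E)%E.
  apply: ge0_nondecreasing_set_cvg_integral => [|i|i|i t _].
  - apply/nondecreasing_seqP => k; apply/subsetPset => t; rewrite /F/= !in_itv/=.
    move=> /andP[kt ->]; rewrite andbT; apply: le_trans kt.
    by rewrite lef_pV2 ?posrE// ler_nat.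
  - exact: measurable_itv.
  - by apply/measurable_EFinP; exact: measurable_powRl.
  - by rewrite lee_fin powR_ge0.
apply: (cvge_to_le cvgF).
by near=> k; apply: integral_powR_itv => //; rewrite invf_lt1// ltr1n.
Unshelve. all: by end_near. Qed.

(** Raise [t / (2 * N) <= expR (t / (2 * N))] to the power [N]. *)
Lemma powR_le_expR (x t : R) (N := (Num.truncn x).+1) : 1 <= t ->
  t `^ (x - 1) <= (2 * N%:R) ^+ N * expR (t / 2).
Proof.
move=> t1; have t0 : 0 < t by exact: lt_le_trans t1.
have N0 : 0 < N%:R :> R by rewrite ltr0n.
apply: le_trans (_ : t `^ N%:R <= _).
  apply: ler_powR => //; apply: le_trans (ltW (truncnS_gt x)).
  by rewrite lerBlDr lerDl.
rewrite powR_mulrn ?(ltW t0)//.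
have -> : t / 2 = N%:R * (t / (2 * N%:R)).
  by field; rewrite gt_eqF.
rewrite expRM_natl -exprMn_comm; last exact: mulrC.
apply: lerXn2r; rewrite ?nnegrE ?(ltW t0)//.
rewrite -ler_pdivrMl ?mulr_gt0// mulrC.
by apply: le_trans (expR_ge1Dx _); rewrite lerDr.
Qed.

Definition gamma_integrand (x t : R) : R := t `^ (x - 1) * expR (- t).

Lemma gamma_integrand_ge0 x t : 0 <= gamma_integrand x t.
Proof. by rewrite mulr_ge0 ?powR_ge0 ?expR_ge0. Qed.

Lemma measurable_gamma_integrand x D : measurable_fun D (gamma_integrand x).
Proof.
apply: measurable_funM; first exact: measurable_powRl.
by apply: measurableT_comp.
Qed.

(** Below [1] the integrand is at most [t `^ (x - 1)]; above [1] it is at most a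
    multiple of the exponential density of rate [1 / 2]. *)
Lemma integrable_gamma_integrand x : 0 < x ->
  leb.-integrable `]0, +oo[ (EFin \o gamma_integrand x).
Proof.
move=> x0; apply/integrableP; split.
  by apply/measurable_EFinP; exact: measurable_gamma_integrand.
under eq_integral do rewrite /= ger0_norm ?gamma_integrand_ge0//.
have -> : [set` `]0%R, +oo[] = [set` `]0, 1]] `|` [set` `]1%R, +oo[] :> set R.
  by apply: itv_bndbnd_setU; rewrite bnd_simp.
have g0 : forall t, (0 <= (gamma_integrand x t)%:E)%E.
  by move=> t; rewrite lee_fin gamma_integrand_ge0.
have mg D : measurable_fun D (EFin \o gamma_integrand x).
  by apply/measurable_EFinP; exact: measurable_gamma_integrand.
rewrite ge0_integral_setU//=; last first.
  apply/disj_setPS => t /=.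
  by rewrite !in_itv/= andbT => -[/andP[_ t1] /lt_le_trans/(_ t1)]; rewrite ltxx.
  by apply/measurable_EFinP; exact: measurable_gamma_integrand.
apply: lte_add_pinfty.
  apply: le_lt_trans (_ : \int[leb]_(t in `]0%R, 1%R]) (t `^ (x - 1))%:E < +oo)%E.
    apply: ge0_le_integral.
    - exact: measurable_itv.
    - by move=> t _; exact: g0.
    - by apply/measurable_EFinP; exact: measurable_gamma_integrand.
    - by apply/measurable_EFinP; exact: measurable_powRl.
    move=> t /=; rewrite in_itv/= => /andP[t0 _].
    rewrite lee_fin -[leRHS]mulr1 ler_wpM2l ?powR_ge0//.
    by rewrite -expR0 ler_expR oppr_le0 ltW.
  by apply: (le_lt_trans (integral_powR_itv0 x0)); rewrite ltry.
set N := (Num.truncn x).+1.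
pose C : R := (2 * N%:R) ^+ N * 2.
have C0 : 0 <= C by rewrite mulr_ge0// exprn_ge0// mulr_ge0.
have h20 : 0 < 2^-1 :> R by rewrite invr_gt0.
have mp : measurable_fun setT (fun t : R => (exponential_pdf 2^-1 t)%:E).
  by apply/measurable_EFinP; exact: measurable_exponential_pdf.
have mCp : measurable_fun setT (fun t : R => C%:E * (exponential_pdf 2^-1 t)%:E)%E.
  exact: measurable_funeM.
apply: le_lt_trans (_ : \int[leb]_t (C%:E * (exponential_pdf 2^-1 t)%:E) < +oo)%E.
  apply: le_trans (_ : (\int[leb]_(t in `]1%R, +oo[)
      (C%:E * (exponential_pdf 2^-1 t)%:E) <= _))%E; last first.
    apply: ge0_subset_integral.
    - exact: measurable_itv.
    - exact: measurableT.
    - exact: mCp.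
    - by move=> t _; rewrite mule_ge0// lee_fin exponential_pdf_ge0// ltW.
    - by [].
  apply: ge0_le_integral.
  - exact: measurable_itv.
  - by move=> t _; exact: g0.
  - by apply/measurable_EFinP; exact: measurable_gamma_integrand.
  - by apply: measurable_funTS; exact: mCp.
  move=> t /=; rewrite in_itv/= andbT => t1.
  have t0 : 0 <= t by rewrite (le_trans _ (ltW t1)).
  rewrite -EFinM lee_fin exponential_pdfE// /C.
  rewrite (_ : _ * 2 * _ = (2 * N%:R) ^+ N * expR (- 2^-1 * t)); last by field.
  apply: le_trans (_ : (2 * N%:R) ^+ N * expR (t / 2) * expR (- t) <= _).
    by rewrite ler_wpM2r ?expR_ge0//; apply: powR_le_expR; rewrite ltW.
  rewrite -mulrA -expRD le_eqVlt; apply/orP; left; apply/eqP.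
  by congr (_ * expR _); field.
rewrite ge0_integralZl//; last first.
  by move=> t _; rewrite lee_fin exponential_pdf_ge0// ltW.
by rewrite integral_exponential_pdf// mule1 ltry.
Qed.

Lemma Gamma_gt0 (x : R) : 0 < x -> 0 < Gamma x.
Proof.
move=> x0; have ig := integrable_gamma_integrand x0.
rewrite lt0r Rintegral_ge0 ?andbT; last first.
  by move=> t _; exact: gamma_integrand_ge0.
apply/eqP => G0.
have : ae_eq leb [set` `]0, +oo[] (EFin \o gamma_integrand x) (cst 0%E).
  apply: (ae_eq0_ge0_Rintegral _ ig _ G0) => // t _.
  exact: gamma_integrand_ge0.
move=> [N [mN N0 sN]].
have : (leb `]0%R, 1%R] <= leb N)%E.
  apply: le_measure; rewrite ?inE// => t; rewrite /= in_itv/= => /andP[t0 _].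
  apply: sN => /= H; have : (gamma_integrand x t)%:E = 0%E.
    by apply: H; rewrite in_itv/= t0.
  move=> [] /eqP; rewrite /gamma_integrand mulf_eq0 expR_eq0 orbF.
  by rewrite gt_eqF// powR_gt0.
by rewrite N0 lebesgue_measure_itv/= lte_fin ltr01 sube0 lee_fin ler10.
Qed.

End gamma_integrand.

Section gamma_function.
Variable R : realType.
Notation leb := (@lebesgue_measure R).
Notation Rpos := ([set` `]0%R, +oo[] : set (measurableTypeR R)) (only parsing).

(** With this weight the gamma function is the Laplace transform of [ln]: the
    results above then give its derivative and its logarithmic convexity. *)
Definition gamma_weight (t : R) : R := t^-1 * expR (- t).

Lemma measurable_inv_itv : measurable_fun Rpos (fun t : R => t^-1).
Proof.
apply: open_continuous_measurable_fun; first exact: interval_open.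
move=> t /set_mem/=; rewrite in_itv/= andbT => t0.
by apply: inv_continuous; rewrite gt_eqF.
Qed.

Lemma measurable_gamma_weight : measurable_fun Rpos gamma_weight.
Proof.
apply: measurable_funM; first exact: measurable_inv_itv.
by apply: measurableT_comp.
Qed.

Lemma gamma_integrandE (x t : R) : 0 < t ->
  gamma_integrand x t = expR (x * ln t) * gamma_weight t.
Proof.
move=> t0; rewrite /gamma_integrand /gamma_weight mulrA; congr (_ * _).
rewrite /powR gt_eqF// mulrBl mul1r expRD; congr (_ * _).
by rewrite expRN lnK// posrE.
Qed.

Lemma Gamma_laplace : @Gamma R = laplace leb Rpos (@ln R) gamma_weight.
Proof.
apply/funext => x; apply: eq_Rintegral => t /set_mem/=.
by rewrite in_itv/= andbT => t0; rewrite -gamma_integrandE.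
Qed.

Lemma gamma_laplace_integrable :
  laplace_integrable leb Rpos (@ln R) gamma_weight.
Proof.
move=> x x0; apply: eq_integrable (integrable_gamma_integrand x0) => //.
move=> t /set_mem/=; rewrite in_itv/= andbT => t0.
by rewrite gamma_integrandE.
Qed.

Definition Gamma' : R -> R :=
  laplace leb Rpos (@ln R) (fun t => ln t * gamma_weight t).

Lemma is_derive_Gamma (x : R) : 0 < x -> is_derive x 1 (@Gamma R) (Gamma' x).
Proof.
move=> x0; rewrite Gamma_laplace; apply: is_derive_laplace => //.
- by apply: measurable_funTS; exact: measurable_ln.
- exact: measurable_gamma_weight.
- exact: gamma_laplace_integrable.
Qed.

Lemma digammaE (x : R) : 0 < x -> digamma x = Gamma' x / Gamma x.
Proof.
by move=> x0; rewrite /digamma derive1E; have [_ ->] := is_derive_Gamma x0.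
Qed.

Lemma digamma_le (x y : R) : 0 < x -> x <= y -> digamma x <= digamma y.
Proof.
move=> x0 xy; rewrite !digammaE//; last exact: lt_le_trans xy.
rewrite Gamma_laplace; apply: laplace_logderiv_le => //.
- by apply: measurable_funTS; exact: measurable_ln.
- exact: measurable_gamma_weight.
- move=> t /=; rewrite in_itv/= andbT => t0.
  by rewrite mulr_ge0 ?expR_ge0// invr_ge0 ltW.
- exact: gamma_laplace_integrable.
- by move=> s s0; rewrite -Gamma_laplace Gamma_gt0.
Qed.

Lemma ge0_integral_gamma_scale (x s : R) : 0 < x -> 0 < s ->
  (\int[leb]_(t in Rpos) (expR (s * - t) * t `^ (x - 1))%:E =
   (s `^ (- x) * Gamma x)%:E)%E.
Proof.
move=> x0 s0.
pose f : measurableTypeR R -> \bar R := (EFin \o gamma_integrand x) \_ Rpos.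
have mf : measurable_fun setT f.
  apply/(measurable_restrictT _ _).1 => //.
  by apply/measurable_EFinP; exact: measurable_gamma_integrand.
have f0 t : (0 <= f t)%E.
  by rewrite /f patchE; case: ifP => // _; rewrite lee_fin gamma_integrand_ge0.
have intf : (\int[leb]_t f t = (Gamma x)%:E)%E.
  rewrite -integral_mkcond.
  by rewrite -(fineK (integrable_fin_num _ (integrable_gamma_integrand x0))).
transitivity (\int[leb]_t ((s `^ (1 - x))%:E * f (s * t + 0)%R))%E.
  rewrite integral_mkcond; apply: eq_integral => t _.
  rewrite addr0 /f !patchE !mem_setE !in_itv/= !andbT pmulr_rgt0//.
  case: ifP => t0; last by rewrite mule0.
  rewrite -EFinM; congr EFin.
  rewrite /= /gamma_integrand powRM ?ltW// mulrN mulrC !mulrA; congr (_ * _).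
  rewrite -powRD; last by apply/implyP => _; rewrite gt_eqF.
  by rewrite (_ : 1 - x + (x - 1) = 0) ?powRr0 ?mul1r//; ring.
rewrite ge0_integralZl//; last first.
- by rewrite lee_fin powR_ge0.
- apply: measurableT_comp => //.
  by apply: measurable_funD => //; apply: measurable_funM.
rewrite ge0_integral_affine// intf -!EFinM; congr EFin.
rewrite mulrA; congr (_ * _).
rewrite -powR_inv1 ?ltW// -powRD; last by apply/implyP => _; rewrite gt_eqF.
by congr (_ `^ _); ring.
Qed.

(** Both sides are minus the derivative at [s = 1] of
    [s |-> s `^ (- x) * Gamma x], which by scaling is the integral of
    [expR (- (s * t)) * t `^ (x - 1)]; on the left it is computed under the
    integral sign. *)
Lemma GammaD1 (x : R) : 0 < x -> Gamma (x + 1) = x * Gamma x.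
Proof.
move=> x0.
pose v (t : R) := t `^ (x - 1).
have mv : measurable_fun Rpos v by exact: measurable_powRl.
have mh : measurable_fun Rpos (fun t : R => - t).
  exact: oppr_measurable.
have v0 s t : 0 <= expR (s * - t) * v t by rewrite mulr_ge0 ?expR_ge0 ?powR_ge0.
have iv : laplace_integrable leb Rpos (fun t => - t) v.
  move=> s s0; apply/integrableP; split.
    apply/measurable_EFinP; apply: measurable_funM => //.
    by apply: measurableT_comp => //; apply: measurable_funM.
  rewrite (eq_integral (fun t : measurableTypeR R =>
      (expR (s * - (t : R)) * t `^ (x - 1))%:E)).
    by rewrite ge0_integral_gamma_scale// ltry.
  by move=> t _ /=; rewrite ger0_norm.
have H1 := @is_derive_laplace R _ _ leb Rpos (measurable_itv _) _ mh
  v 1 mv iv ltr01.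
have H2 : is_derive (1 : R) 1 (fun s => s `^ (- x) * Gamma x)
    (- x * 1 `^ (- x - 1) * Gamma x).
  have H := is_derive_powR (- x) (@ltr01 R).
  by apply: is_derive_eq; rewrite /GRing.scale/= mulr0 add0r mulrC.
have H3 : is_derive (1 : R) 1 (laplace leb Rpos (fun t => - t) v)
    (- x * 1 `^ (- x - 1) * Gamma x).
  apply: near_eq_is_derive H2; near=> s.
  have s0 : 0 < s by near: s; exact: lt_nbhsr.
  by rewrite /laplace /Rintegral ge0_integral_gamma_scale.
have : laplace leb Rpos (fun t => - t) (fun t => - t * v t) 1 =
    - x * 1 `^ (- x - 1) * Gamma x.
  by have [_ <-] := H1; have [_ <-] := H3.
rewrite powR1 mulr1 mulNr => E; apply: oppr_inj; rewrite -E.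
have x10 : 0 < x + 1 by rewrite addr_gt0.
rewrite -[LHS]mulN1r -(RintegralZl _ _ (integrable_gamma_integrand x10))//.
apply: eq_Rintegral => t /set_mem/=; rewrite in_itv/= andbT => t0.
rewrite !mul1r mulN1r /gamma_integrand addrK [RHS]mulrC mulNr mulNr /v.
congr (- (_ * _)).
by rewrite mulr_powRB1// ltW.
Unshelve. all: by end_near. Qed.

Lemma digammaD1 (x : R) : 0 < x -> digamma (x + 1) = digamma x + x^-1.
Proof.
move=> x0; have x10 : 0 < x + 1 by rewrite addr_gt0.
rewrite !digammaE// GammaD1//.
have G0 := lt0r_neq0 (Gamma_gt0 x0).
have H1 : is_derive x 1 (fun s => Gamma (s + 1)) (Gamma' (x + 1)).
  have := is_derive_Gamma x10 => H.
  have H0 : is_derive x 1 (fun s : R => s + 1) 1.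
    by apply: is_derive_eq; rewrite addr0.
  have := @is_derive1_comp R (@Gamma R) (fun s => s + 1) x _ _ H H0.
  by rewrite mulr1.
have H2 : is_derive x 1 (fun s => s * Gamma s) (x * Gamma' x + Gamma x).
  have := is_derive_Gamma x0 => H.
  by apply: is_derive_eq; rewrite /GRing.scale/= mulr1.
have H3 : is_derive x 1 (fun s => Gamma (s + 1)) (x * Gamma' x + Gamma x).
  apply: near_eq_is_derive H2; near=> s.
  by rewrite GammaD1//; near: s; exact: lt_nbhsr.
have -> : Gamma' (x + 1) = x * Gamma' x + Gamma x.
  by have [_ <-] := H1; have [_ <-] := H3.
by field; rewrite G0 gt_eqF.
Unshelve. all: by end_near. Qed.

Lemma digamma_addn_le (x : R) N : 0 < x ->
  digamma (x + N%:R) <= digamma x + N%:R / x.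
Proof.
move=> x0; elim: N => [|N IH]; first by rewrite addr0 mul0r addr0.
have xN0 : 0 < x + N%:R by rewrite ltr_wpDr.
rewrite -natr1 addrA (digammaD1 xN0) mulrDl addrA mul1r.
by apply: lerD IH _; rewrite lef_pV2 ?posrE// lerDl.
Qed.

(** Monotonicity and the recurrence alone control the increments of the digamma
    function: [a] is at most the integer [(Num.truncn a).+1], and each step of the
    recurrence adds at most [x^-1]. *)
Lemma digamma_add_le (x a : R) : 0 < x -> 0 <= a ->
  digamma x <= digamma (x + a) <= digamma x + (Num.truncn a).+1%:R / x.
Proof.
move=> x0 a0; apply/andP; split; first by apply: digamma_le; rewrite ?lerDl.
apply: le_trans (digamma_addn_le _ x0); apply: digamma_le.
  by rewrite ltr_wpDr.
by rewrite lerD2l ltW// truncnS_gt.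
Qed.

End gamma_function.

(** * The integral of a power of 1 - |u|^2 over the unit ball *)

Section ball_integral.
Variable R : realType.
Local Open Scope ereal_scope.
Notation leb := (@lebesgue_measure R).
Notation Rpos := ([set` `]0%R, +oo[] : set (measurableTypeR R)) (only parsing).

Definition ball_kernel (s z : R) : R :=
  if (z < 1)%R then ((1 - z) `^ (s - 1))%R else 0%R.

Definition ball_integral k (s : R) : \bar R :=
  \int[lebesgue_tuple R k]_u (ball_kernel s (sqnorm u))%:E.

Lemma ball_kernel_ge0 s z : (0 <= ball_kernel s z)%R.
Proof. by rewrite /ball_kernel; case: ifP => // _; rewrite powR_ge0. Qed.

Lemma measurable_ball_kernel s :
  measurable_fun setT (ball_kernel s : measurableTypeR R -> R).
Proof.
apply: measurable_fun_ifT => //.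
  exact: measurable_fun_ltr.
apply: (measurableT_comp (measurable_powR (s - 1))).
exact: measurable_funB.
Qed.

Lemma integral_gauss_tuple k :
  \int[lebesgue_tuple R k]_u (expR (- sqnorm u))%:E = (Num.sqrt pi ^+ k)%:E.
Proof.
have m k' : measurable_fun setT (fun u : Rtuple R k' => (expR (- sqnorm u))%:E).
  apply/measurable_EFinP; apply: measurableT_comp => //.
  by apply: measurable_funN; exact: measurable_sqnorm.
elim: k => [|k IH].
  by rewrite ge0_integral_tuple0 /sqnorm big_ord0 oppr0 expR0 expr0.
rewrite ge0_integral_tuple_cons//.
transitivity (\int[leb]_a ((gauss_fun a)%:E * (Num.sqrt pi ^+ k)%:E)).
  apply: eq_integral => a _; rewrite -IH -ge0_integralZl//=.
  - apply: eq_integral => u _.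
    by rewrite sqnorm_cons opprD expRD EFinM.
  - exact: m.
  - by rewrite lee_fin gauss_fun_ge0.
rewrite ge0_integralZr//=.
- by rewrite integralT_gauss -EFinM exprS.
- by apply/measurable_EFinP; exact: measurable_gauss_fun.
- by move=> a _; rewrite lee_fin gauss_fun_ge0.
Qed.

Lemma posdef_scalar k (w : R) : (0 < w)%R -> posdef (w%:M : 'M[R]_k).
Proof.
move=> w0; split; first by rewrite tr_scalar_mx.
move=> v /rV0Pn[i vi0]; rewrite mul_mx_scalar -scalemxAl mxE pmulr_rgt0// mxE.
rewrite (bigD1 i)//= ltr_pwDl//.
  by rewrite mxE -expr2 exprn_even_gt0.
by apply: sumr_ge0 => j _; rewrite mxE -expr2 sqr_ge0.
Qed.

Lemma quad_scalar k (w : R) (u : Rtuple R k) : quad w%:M u = (w * sqnorm u)%R.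
Proof.
rewrite /quad mul_mx_scalar -scalemxAl mxE mxE; congr (_ * _)%R.
by apply: eq_bigr => i _; rewrite !mxE expr2.
Qed.

(** Computing the integral of [t ^ (s - 1) * exp (- t - |u|^2)] over [t > 0]
    and [u] in [R^k] in two ways; the second one takes [w = t + |u|^2] as a
    variable and rescales the ball of squared radius [w]. *)
Lemma ball_integralE k (s : R) : (0 < s)%R -> ball_integral k s =
  (Num.sqrt pi ^+ k * Gamma s / Gamma (s + k%:R / 2))%:E.
Proof.
move=> s0.
have sk0 : (0 < s + k%:R / 2)%R by rewrite ltr_wpDr.
have Gk0 := Gamma_gt0 sk0.
pose f : measurableTypeR R -> \bar R := (EFin \o gamma_integrand s) \_ Rpos.
have mf : measurable_fun setT f.
  apply/(measurable_restrictT _ _).1 => //.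
  by apply/measurable_EFinP; exact: measurable_gamma_integrand.
have f0 t : 0 <= f t.
  by rewrite /f patchE; case: ifP => // _; rewrite lee_fin gamma_integrand_ge0.
have intf : \int[leb]_t f t = (Gamma s)%:E.
  rewrite -integral_mkcond.
  by rewrite -(fineK (integrable_fin_num _ (integrable_gamma_integrand s0))).
pose K (z : Rtuple R k * measurableTypeR R) :=
  f (1 * z.2 + - sqnorm z.1)%R * (expR (- sqnorm z.1))%:E.
have K0 z : 0 <= K z by rewrite mule_ge0// lee_fin expR_ge0.
have msq : measurable_fun setT
    (fun z : Rtuple R k * measurableTypeR R => sqnorm z.1).
  by apply: measurableT_comp; [exact: measurable_sqnorm|exact: measurable_fst].
have mK : measurable_fun setT K.
  apply: emeasurable_funM.
    apply: measurableT_comp => //.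
    apply: measurable_funD; last exact: measurable_funN.
    by apply: measurable_funM => //; exact: measurable_snd.
  by apply/measurable_EFinP; apply: measurableT_comp => //; exact: measurable_funN.
have mexp : measurable_fun setT (fun u : Rtuple R k => (expR (- sqnorm u))%:E).
  apply/measurable_EFinP; apply: measurableT_comp => //.
  by apply: measurable_funN; exact: measurable_sqnorm.
have E1 : \int[lebesgue_tuple R k]_u \int[leb]_w K (u, w) =
    (Num.sqrt pi ^+ k * Gamma s)%:E.
  transitivity (\int[lebesgue_tuple R k]_u
      ((Gamma s)%:E * (expR (- sqnorm u))%:E)).
    apply: eq_integral => u _; rewrite /K/= ge0_integralZr//; last first.
      by apply: (measurableT_comp mf); apply: measurable_funD.
    by rewrite ge0_integral_affine// invr1 mul1e intf.
  rewrite (ge0_integralZl _ measurableT mexp); last 2 first.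
  - by move=> u _; rewrite lee_fin expR_ge0.
  - by rewrite lee_fin; apply/ltW/Gamma_gt0.
  by rewrite integral_gauss_tuple -EFinM mulrC.
have E2 : \int[leb]_w \int[lebesgue_tuple R k]_u K (u, w) =
    (Gamma (s + k%:R / 2))%:E * ball_integral k s.
  transitivity (\int[leb]_w (((EFin \o gamma_integrand (s + k%:R / 2)) \_ Rpos) w *
      ball_integral k s)).
    apply: eq_integral => w _; rewrite patchE mem_setE in_itv/= andbT.
    have KE u : K (u, w) = if (sqnorm u < w)%R then
        ((w - sqnorm u) `^ (s - 1) * expR (- w))%:E else 0.
      rewrite /K/= /f patchE mem_setE in_itv/= andbT mul1r subr_gt0.
      case: ifP => uw; last by rewrite mul0e.
      rewrite /= -EFinM /gamma_integrand -mulrA -expRD; congr (_ * expR _)%:E.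
      by ring.
    case: ifPn => w0; last first.
      rewrite mul0e integral0_eq// => u _; rewrite KE ifF//.
      apply/negbTE; rewrite -leNgt; rewrite -leNgt in w0.
      exact: le_trans w0 (sqnorm_ge0 u).
    transitivity (\int[lebesgue_tuple R k]_u ((w `^ (s - 1) * expR (- w))%:E *
        (ball_kernel s (quad w^-1%:M u))%:E)).
      apply: eq_integral => u _; rewrite KE quad_scalar /ball_kernel.
      rewrite [(w^-1 * _)%R]mulrC ltr_pdivrMr// mul1r.
      case: ifP => uw; last by rewrite mule0.
      rewrite -EFinM mulrAC -powRM ?(ltW w0)//; last first.
        by rewrite subr_ge0 ler_pdivrMr// mul1r ltW.
      by congr (_ `^ _ * _)%:E; field; rewrite gt_eqF.
    have mbk : measurable_fun setT
        (fun u : Rtuple R k => (ball_kernel s (quad w^-1%:M u))%:E).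
      apply/measurable_EFinP.
      apply: (measurableT_comp (measurable_ball_kernel s)).
      exact: measurable_quad.
    rewrite (ge0_integralZl _ measurableT mbk); last 2 first.
    - by move=> u _; rewrite lee_fin ball_kernel_ge0.
    - by rewrite lee_fin mulr_ge0 ?powR_ge0 ?expR_ge0.
    rewrite (@ge0_integral_quad _ _ _ (fun z => (ball_kernel s z)%:E)); last 3 first.
    - by apply: posdef_scalar; rewrite invr_gt0.
    - by apply/measurable_EFinP; exact: measurable_ball_kernel.
    - by move=> z; rewrite lee_fin ball_kernel_ge0.
    rewrite -/(ball_integral k s) muleA -EFinM; congr (_%:E * _).
    rewrite det_scalar /gamma_integrand mulrAC; congr (_ * _)%R.
    have -> : ((Num.sqrt (w^-1 ^+ k))^-1 = w `^ (k%:R / 2))%R.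
      rewrite -powR12_sqrt ?exprn_ge0 ?invr_ge0 ?(ltW w0)//.
      rewrite -powR_mulrn ?invr_ge0 ?(ltW w0)// -powR_inv1 ?(ltW w0)//.
      rewrite -!powRrM -powRN.
      by congr (_ `^ _)%R; field.
    rewrite -powRD; last by apply/implyP => _; rewrite gt_eqF.
    by congr (_ `^ _)%R; ring.
  rewrite ge0_integralZr//.
  - rewrite -integral_mkcond.
    by rewrite -(fineK (integrable_fin_num _ (integrable_gamma_integrand sk0))).
  - apply/(measurable_restrictT _ _).1 => //.
    by apply/measurable_EFinP; exact: measurable_gamma_integrand.
  - move=> w _; rewrite patchE; case: ifP => // _.
    by rewrite lee_fin gamma_integrand_ge0.
  - by apply: integral_ge0 => u _; rewrite lee_fin ball_kernel_ge0.
have := fubini_tonelli (m1 := lebesgue_tuple R k) (m2 := leb) K mK K0.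
rewrite E1 E2 => E.
have -> : (Num.sqrt pi ^+ k * Gamma s / Gamma (s + k%:R / 2))%:E =
    (Gamma (s + k%:R / 2))^-1%:E * (Num.sqrt pi ^+ k * Gamma s)%:E.
  by rewrite -EFinM mulrC.
by rewrite E muleA -EFinM mulVf ?mul1e// gt_eqF.
Qed.

End ball_integral.

(** * Bordering a correlation matrix *)

Section coordinates_recursion.
Variable R : realType.

Lemma enum_prod (S T : finType) :
  enum {: S * T} = [seq (x, y) | x <- enum S, y <- enum T].
Proof. by rewrite [LHS]enumT Finite.enum.unlock. Qed.

Lemma offdiag_idxS n : offdiag_idx n.+1 =
  [seq (ord0, lift ord0 j) | j <- enum 'I_n] ++
  [seq (lift ord0 p.1, lift ord0 p.2) | p <- offdiag_idx n].
Proof.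
rewrite /offdiag_idx !enum_prod !enum_ordSl allpairs_cons/= filter_cat.
congr (_ ++ _).
  rewrite -map_comp filter_map (eq_filter (a2 := xpredT)) ?filter_predT//.
elim: (enum 'I_n) {1 3}(enum 'I_n) => //= i s IH t.
rewrite !filter_cat map_cat IH; congr (_ ++ _).
by rewrite /= -!map_comp !filter_map -map_comp.
Qed.

Lemma offdiag_dimS n : (n + offdiag_dim n)%N = offdiag_dim n.+1.
Proof. by rewrite /offdiag_dim -!bin2 binS bin1 addnC. Qed.

(** The coordinates list the rows one after another, so those of a matrix of
    size [n.+1] are the off-diagonal part [u] of its first row, followed by the
    coordinates [x] of the matrix without its first row and column. *)
Definition cons_coord n (u : Rtuple R n) (x : Rtuple R (offdiag_dim n)) :
  Rtuple R (offdiag_dim n.+1) := tcast (offdiag_dimS n) [tuple of u ++ x].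

Lemma offdiag_inj n (C D : 'M[R]_n) : C^T = C -> D^T = D ->
  (forall i, C i i = D i i) -> offdiag C = offdiag D -> C = D.
Proof.
move=> CT DT CD /(congr1 val)/= /eq_in_map offCD; apply/matrixP => i j.
have ltCD (a b : 'I_n) : (a < b)%N -> C a b = D a b.
  by move=> ab; apply: (offCD (a, b)); rewrite mem_filter ab mem_enum.
case: (ltngtP i j) => [/ltCD//|ji|/val_inj ->//].
by rewrite -CT -DT !mxE ltCD.
Qed.

Lemma corr_mxT n (x : Rtuple R (offdiag_dim n)) : (corr_mx x)^T = corr_mx x.
Proof.
apply/matrixP => i j; rewrite !mxE eq_sym; have [//|ij] := eqVneq i j.
case: ltngtP => // ji.
by move/val_inj : ji => ji; rewrite ji eqxx in ij.
Qed.

Lemma corr_mx_diag n (x : Rtuple R (offdiag_dim n)) i : corr_mx x i i = 1.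
Proof. by rewrite mxE eqxx. Qed.

Lemma corr_mx_cons n (u : Rtuple R n) (x : Rtuple R (offdiag_dim n)) :
  corr_mx (cons_coord u x) =
  block_mx 1%:M (rowt u) (rowt u)^T (corr_mx x) :> 'M[R]_(1 + n).
Proof.
set M := block_mx _ _ _ _.
have MT : M^T = M by rewrite /M tr_block_mx tr_scalar_mx trmxK corr_mxT.
have Mul (i j : 'I_n) : M (lift ord0 i) (lift ord0 j) = corr_mx x i j.
  by rewrite -(block_mxEdr (1%:M : 'M[R]_1) (rowt u) (rowt u)^T (corr_mx x));
    congr (M _ _); exact: val_inj.
have Mur (j : 'I_n) : M ord0 (lift ord0 j) = tnth u j.
  rewrite -[RHS](mxE matrix_key (fun _ : 'I_1 => tnth u) ord0 j).
  rewrite -(block_mxEur (1%:M : 'M[R]_1) (rowt u) (rowt u)^T (corr_mx x)).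
  by congr (M _ _); exact: val_inj.
have M1 i : M i i = 1.
  case: (split_ordP i) => j ->; first by rewrite block_mxEul !mxE (ord1 j).
  by rewrite block_mxEdr corr_mx_diag.
apply: offdiag_inj => [|//|i|]; [exact: corr_mxT|by rewrite corr_mx_diag M1|].
rewrite corr_mxK.
apply: val_inj; rewrite /cons_coord /= val_tcast offdiag_idxS map_cat.
congr (_ ++ _).
- by rewrite -[LHS]map_tnth_enum -[RHS]map_comp; apply: eq_map => j /=; rewrite Mur.
- rewrite -[RHS]map_comp -{1}[x]corr_mxK /=; apply: eq_map => p /=.
  by rewrite Mul.
Qed.

(** Completing the square in all coordinates but the first. *)
Lemma quad_border k (s : R) (r y : 'rV[R]_k) (C : 'M[R]_k) :
  C^T = C -> C \in unitmx ->
  (row_mx s%:M y *m block_mx 1%:M r r^T C *m (row_mx s%:M y)^T) 0 0 =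
  s ^+ 2 * (1 - (r *m invmx C *m r^T) 0 0) +
  ((y + s *: (r *m invmx C)) *m C *m (y + s *: (r *m invmx C))^T) 0 0.
Proof.
move=> CT uC; rewrite quad_block.
have iCT : (invmx C)^T = invmx C by rewrite trmx_inv CT.
have -> : (y + s *: (r *m invmx C)) *m C *m (y + s *: (r *m invmx C))^T =
   y *m C *m y^T + s *: (r *m y^T)^T + s *: (r *m y^T) +
   (s ^+ 2) *: (r *m invmx C *m r^T).
  rewrite linearD linearZ/= !mulmxDl -scalemxAl mulmxKV// !mulmxDr.
  rewrite trmx_mul iCT -!scalemxAr -!scalemxAl !mulmxA mulmxK//.
  by rewrite scalerA -expr2 trmx_mul trmxK !addrA.
by rewrite !mxE; ring.
Qed.

Lemma det_border k (r : 'rV[R]_k) (C : 'M[R]_k) : C \in unitmx ->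
  \det (block_mx 1%:M r r^T C) = \det C * (1 - (r *m invmx C *m r^T) 0 0).
Proof.
move=> uC.
have -> : block_mx 1%:M r r^T C =
    block_mx 1%:M (r *m invmx C) 0 1%:M *m
    block_mx (1 - (r *m invmx C *m r^T) 0 0)%:M 0 r^T C.
  rewrite mulmx_block !mul1mx !mul0mx !add0r mulmxKV//.
  have {2}-> : r *m invmx C *m r^T = ((r *m invmx C *m r^T) 0 0)%:M.
    exact: mx11_scalar.
  by rewrite -raddfD/= subrK.
by rewrite det_mulmx det_ublock det_lblock !det1 !mul1r det_scalar1 mulrC.
Qed.

(** By [quad_border] the form is the form of [C] at a shifted vector plus [s ^+ 2]
    times the factor [1 - r C^-1 r^T] by which bordering multiplies the
    determinant. *)
Lemma posdef_border k (r : 'rV[R]_k) (C : 'M[R]_k) :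
  posdef (block_mx 1%:M r r^T C) <->
  posdef C /\ (r *m invmx C *m r^T) 0 0 < 1.
Proof.
split=> [[MT M0]|[pC q1]].
  have CT : C^T = C.
    by have := MT; rewrite tr_block_mx => /eq_block_mx[].
  have pC : posdef C.
    split=> // y y0.
    have /M0 : row_mx (0%:M : 'M[R]_1) y != 0.
      by rewrite row_mx_eq0 negb_and y0 orbT.
    by rewrite quad_block expr0n !mulr0 mul0r !add0r.
  have uC : C \in unitmx by rewrite unitmxE unitfE gt_eqF// posdef_det_gt0.
  split=> //.
  have /M0 : row_mx (1%:M : 'M[R]_1) (- (r *m invmx C)) != 0.
    rewrite row_mx_eq0 negb_and; apply/orP; left.
    by apply/eqP => /matrixP/(_ 0 0); rewrite !mxE/= => /eqP; rewrite oner_eq0.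
  rewrite quad_border// scale1r addNr !mul0mx [X in _ + X]mxE addr0 expr1n mul1r.
  by rewrite subr_gt0.
have [CT C0] := pC.
have uC : C \in unitmx by rewrite unitmxE unitfE gt_eqF// posdef_det_gt0.
split; first by rewrite tr_block_mx tr_scalar_mx trmxK CT.
move=> v; rewrite -[v]hsubmxK [lsubmx v]mx11_scalar.
set s := lsubmx v 0 0; set y := rsubmx v => v0.
rewrite quad_border//; have [s0|s0] := eqVneq s 0; last first.
  rewrite ltr_pwDl//; first by rewrite mulr_gt0 ?subr_gt0// exprn_even_gt0.
  have [->|w0] := eqVneq (y + s *: (r *m invmx C)) 0.
    by rewrite !mul0mx mxE.
  by rewrite ltW// C0.
rewrite s0 expr0n mul0r add0r scale0r addr0 C0//.
move: v0; rewrite row_mx_eq0 negb_and s0 => /orP[|//].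
by move=> /eqP[]; apply/matrixP => i j; rewrite !mxE mul0rn.
Qed.

End coordinates_recursion.

(** * The normalizing constant, one row at a time *)

Section normalizing_constant.
Variable R : realType.
Notation leb := (@lebesgue_measure R).

Lemma posdef_psd k (C : 'M[R]_k) : posdef C -> forall v : 'rV[R]_k,
  0 <= (v *m C *m v^T) 0 0.
Proof.
move=> [_ C0] v; have [->|v0] := eqVneq v 0; first by rewrite !mul0mx mxE.
by rewrite ltW// C0.
Qed.

(** A vector [v] on which a semidefinite form vanishes lies in its kernel: at
    [v + t *: w] the form is [2 * t * b + t ^+ 2 * c], which is nonnegative for
    all [t] only if [b = 0]. *)
Lemma psd_posdef k (C : 'M[R]_k) : C^T = C ->
  (forall v : 'rV[R]_k, 0 <= (v *m C *m v^T) 0 0) -> \det C != 0 -> posdef C.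
Proof.
move=> CT C0 dC; split=> // v v0; rewrite lt0r C0 andbT; apply/negP => /eqP vCv.
have uC : C \in unitmx by rewrite unitmxE unitfE.
have vC (w : 'rV[R]_k) : (v *m C *m w^T) 0 0 = 0.
  set b := (v *m C *m w^T) 0 0; set c := (w *m C *m w^T) 0 0.
  have E t : ((v + t *: w) *m C *m (v + t *: w)^T) 0 0 = 2 * t * b + t ^+ 2 * c.
    have wCv : w *m C *m v^T = (v *m C *m w^T)^T.
      by rewrite !trmx_mul trmxK CT mulmxA.
    rewrite linearD linearZ/= !mulmxDl !mulmxDr -!scalemxAl -!scalemxAr wCv.
    rewrite [v *m C *m v^T]mx11_scalar vCv [v *m C *m w^T]mx11_scalar.
    rewrite [w *m C *m w^T]mx11_scalar -/b -/c tr_scalar_mx !scale_scalar_mx.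
    by rewrite -!raddfD/= mxE eqxx mulr1n; ring.
  apply/eqP/negPn/negP => b0.
  have c0 : 0 <= c by exact: C0.
  (* The denominator is [c + 1] because [c] may vanish. *)
  have := C0 (v + (- b / (c + 1)) *: w); rewrite E.
  have c1 : 0 < c + 1 by rewrite ltr_wpDl.
  have c2 : 0 < c + 2 by rewrite ltr_wpDl.
  have -> : 2 * (- b / (c + 1)) * b + (- b / (c + 1)) ^+ 2 * c =
      - (b ^+ 2 * (c + 2) / (c + 1) ^+ 2).
    by field; rewrite gt_eqF.
  rewrite oppr_ge0 leNgt => /negP[].
  by rewrite divr_gt0 ?exprn_gt0// mulr_gt0// exprn_even_gt0.
have : v *m C = 0.
  apply/rowP => i; have := vC (delta_mx 0 i).
  by rewrite trmx_delta -colE !mxE.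
move=> /(congr1 (mulmx^~ (invmx C))); rewrite mulmxK// mul0mx => /eqP.
by rewrite (negbTE v0).
Qed.

Definition posdef_coord n : set (Rtuple R (offdiag_dim n)) :=
  [set x | posdef (corr_mx x)].
Arguments posdef_coord : clear implicits.

Lemma posdef_coordE n : posdef_coord n =
  @elliptope_coord R n `&` [set x | 0 < \det (corr_mx x)].
Proof.
rewrite elliptope_coordE; apply/seteqP; split=> x.
  move=> pC; split; last exact: posdef_det_gt0.
  split; [by have [] := pC|exact: posdef_psd|exact: corr_mx_diag].
by move=> [[CT C0 _] /lt0r_neq0 dC]; exact: psd_posdef.
Qed.

Lemma measurable_posdef_coord n : measurable (posdef_coord n).
Proof.
rewrite posdef_coordE; apply: measurableI; first exact: measurable_elliptope_coord.
have := @measurable_det_corr_mx R n measurableT _ (measurable_itv `]0%R, +oo[).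
rewrite setTI; congr measurable; apply/seteqP; split=> x /=;
  by rewrite in_itv/= andbT.
Qed.

Lemma posdef_coord_cons n (u : Rtuple R n) (x : Rtuple R (offdiag_dim n)) :
  posdef_coord n.+1 (cons_coord u x) <->
  posdef_coord n x /\ quad (invmx (corr_mx x)) u < 1.
Proof. by rewrite /posdef_coord/= corr_mx_cons; exact: posdef_border. Qed.

Lemma posdef_inv k (C : 'M[R]_k) : posdef C -> posdef (invmx C).
Proof.
move=> pC; have [CT C0] := pC.
have uC : C \in unitmx by rewrite unitmxE unitfE gt_eqF// posdef_det_gt0.
have iCT : (invmx C)^T = invmx C by rewrite trmx_inv CT.
split=> // v v0.
have -> : v *m invmx C *m v^T = (v *m invmx C) *m C *m (v *m invmx C)^T.
  by rewrite trmx_mul iCT mulmxKV// mulmxA.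
apply: C0; apply: contra v0 => /eqP /(congr1 (mulmx^~ C)).
by rewrite mulmxKV// mul0mx => ->.
Qed.

Lemma measurable_cons_coord n : measurable_fun setT
  (fun z : Rtuple R n * Rtuple R (offdiag_dim n) => cons_coord z.1 z.2).
Proof. exact: measurable_tuple_cat. Qed.

Lemma ge0_integral_coordS n (f : Rtuple R (offdiag_dim n.+1) -> \bar R) :
    measurable_fun setT f -> (forall x, 0 <= f x)%E ->
  (\int[lebesgue_tuple R (offdiag_dim n.+1)]_x f x =
   \int[lebesgue_tuple R (offdiag_dim n)]_x \int[lebesgue_tuple R n]_u
     f (cons_coord u x))%E.
Proof.
move=> mf f0; rewrite (ge0_integral_tuple_cat (offdiag_dimS n) mf f0).
apply: (fubini_tonelli (fun z => f (cons_coord z.1 z.2))) => [|z]; last exact: f0.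
exact: (measurableT_comp mf (@measurable_cons_coord n)).
Qed.

Lemma measurable_det_powR n (a : R) : measurable_fun setT
  (fun x : Rtuple R (offdiag_dim n) => \det (corr_mx x) `^ a).
Proof.
apply: (measurableT_comp (measurable_powR a)).
exact: measurable_det_corr_mx.
Qed.

(** The integral of the LKJ weight, restricted to the matrices of positive
    determinant: on these the recursion below holds exactly. *)
Definition lkj_integral n (s : R) : \bar R :=
  (\int[lebesgue_tuple R (offdiag_dim n)]_(x in posdef_coord n)
    (\det (corr_mx x) `^ (s - 1))%:E)%E.

(** For a fixed minor [C] the first row [u] ranges over the ellipsoid
    [u C^-1 u^T < 1] and the determinant is [\det C * (1 - u C^-1 u^T)].
    Mapping the ellipsoid to the unit ball yields a factor
    [\det C `^ 2^-1], hence the shift of [s]. *)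
Lemma lkj_integralS n (s : R) :
  (lkj_integral n.+1 s = ball_integral n s * lkj_integral n (s + 2^-1))%E.
Proof.
have mdet n' (t : R) D : measurable_fun D
    (fun x : Rtuple R (offdiag_dim n') => (\det (corr_mx x) `^ (t - 1))%:E).
  apply: measurable_funTS; apply/measurable_EFinP.
  exact: measurable_det_powR.
have mres n' (t : R) : measurable_fun setT
    ((fun x => (\det (corr_mx x) `^ (t - 1))%:E) \_ (posdef_coord n')).
  by apply/(measurable_restrictT _ _).1;
    [exact: measurable_posdef_coord|exact: mdet].
have res0 n' (t : R) x :
    (0 <= ((fun x => (\det (corr_mx x) `^ (t - 1))%:E) \_ (posdef_coord n')) x)%E.
  by rewrite patchE; case: ifP => // _; rewrite lee_fin powR_ge0.
rewrite /lkj_integral integral_mkcond [in RHS]integral_mkcond.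
rewrite ge0_integral_coordS//; last by move=> x; exact: res0.
rewrite -(ge0_integralZl _ measurableT (mres n (s + 2^-1))); last 2 first.
- by move=> x _; exact: res0.
- by apply: integral_ge0 => u _; rewrite lee_fin ball_kernel_ge0.
apply: eq_integral => x _; rewrite [in RHS]patchE.
have [xP|xP] := boolP (x \in posdef_coord n); last first.
  rewrite mule0 integral0_eq// => u _; rewrite patchE ifF//.
  apply/negbTE; apply: contra xP; rewrite !inE => /posdef_coord_cons[//].
rewrite inE in xP.
set C := corr_mx x; have d0 : 0 < \det C := posdef_det_gt0 xP.
transitivity (\int[lebesgue_tuple R n]_u ((\det C `^ (s - 1))%:E *
    (ball_kernel s (quad (invmx C) u))%:E))%E.
  apply: eq_integral => u _; rewrite patchE /ball_kernel.
  have -> : (cons_coord u x \in posdef_coord n.+1) = (quad (invmx C) u < 1).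
    by apply/idP/idP => [/set_mem/posdef_coord_cons[]//|q1];
      rewrite inE; apply/posdef_coord_cons.
  case: ifP => q1; last by rewrite mule0.
  rewrite -EFinM corr_mx_cons det_border ?powRM ?(ltW d0)//.
    by rewrite subr_ge0 ltW.
  by rewrite unitmxE unitfE gt_eqF.
have mbk : measurable_fun setT
    (fun u : Rtuple R n => (ball_kernel s (quad (invmx C) u))%:E).
  apply/measurable_EFinP; apply: (measurableT_comp (measurable_ball_kernel s)).
  exact: measurable_quad.
rewrite (ge0_integralZl _ measurableT mbk); last 2 first.
- by move=> u _; rewrite lee_fin ball_kernel_ge0.
- by rewrite lee_fin powR_ge0.
rewrite (@ge0_integral_quad _ _ _ (fun z => (ball_kernel s z)%:E)); last 3 first.
- exact: posdef_inv.
- by apply/measurable_EFinP; exact: measurable_ball_kernel.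
- by move=> z; rewrite lee_fin ball_kernel_ge0.
rewrite -/(ball_integral n s) muleA [RHS]muleC -EFinM; congr (_%:E * _)%E.
rewrite det_inv sqrtrV ?(ltW d0)// invrK -powR12_sqrt ?(ltW d0)//.
rewrite -powRD; last by apply/implyP => _; rewrite gt_eqF.
by congr (_ `^ _); field.
Qed.

(** Fixing all coordinates but the first leaves at most two points. *)
Lemma integral_sphere k :
  (\int[lebesgue_tuple R k]_u (\1_[set 1 : R] (sqnorm u) : R)%:E = 0)%E.
Proof.
have m1 : measurable_fun setT (fun z : R => (\1_[set 1 : R] z : R)%:E).
  by apply/measurable_EFinP; apply: measurable_indic; exact: measurable_set1.
case: k => [|k].
  rewrite ge0_integral_tuple0 /sqnorm big_ord0 indicE memNset//= => /eqP.
  by rewrite eq_sym oner_eq0.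
rewrite ge0_integral_tuple_cons//; last first.
  by apply: (measurableT_comp m1); exact: measurable_sqnorm.
have msq : measurable_fun setT (fun z : measurableTypeR R * Rtuple R k =>
    (\1_[set 1 : R] (z.1 ^+ 2 + sqnorm z.2) : R)%:E).
  apply: (measurableT_comp m1); apply: measurable_funD.
    by apply: measurable_funX; exact: measurable_fst.
  by apply: measurableT_comp; [exact: measurable_sqnorm|exact: measurable_snd].
transitivity (\int[leb]_a \int[lebesgue_tuple R k]_u
    (\1_[set 1 : R] (a ^+ 2 + sqnorm u)%R : R)%:E)%E.
  by apply: eq_integral => a _; apply: eq_integral => u _; rewrite sqnorm_cons.
rewrite (fubini_tonelli (fun z : measurableTypeR R * Rtuple R k =>
    (\1_[set 1 : R] (z.1 ^+ 2 + sqnorm z.2) : R)%:E))//.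
apply: integral0_eq => u _.
set r := Num.sqrt (1 - sqnorm u).
have sub : [set a : measurableTypeR R | a ^+ 2 + sqnorm u = 1] `<=`
    [set r; - r].
  move=> a /= Ea; have Er : `|a| = r.
    by rewrite -sqrtr_sqr /r -Ea addrK.
  have [a0|a0] := ger0P a; first by left; rewrite -Er ger0_norm.
  by right; rewrite -Er ltr0_norm// opprK.
have mS : measurable [set a : measurableTypeR R | a ^+ 2 + sqnorm u = 1].
  have : measurable_fun setT (fun a : measurableTypeR R => a ^+ 2 + sqnorm u).
    by apply: measurable_funD.
  by move=> /(_ measurableT _ (measurable_set1 1)); rewrite setTI.
transitivity (leb [set a : measurableTypeR R | a ^+ 2 + sqnorm u = 1]).
  rewrite -[X in leb X]setIT -(integral_indic _ measurableT mS).
  by apply: eq_integral => a _; rewrite !indicE; congr ((nat_of_bool _)%:R%:E).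
apply/eqP; rewrite -measure_le0.
apply: le_trans (le_measure _ _ _ sub) _; rewrite ?inE//.
  by apply: measurableU; exact: measurable_set1.
apply: le_trans (measureU2 _ _ _) _; try exact: measurable_set1.
rewrite [X in (X + _)%E]lebesgue_measure_set1.
by rewrite [X in (_ + X)%E]lebesgue_measure_set1 adde0.
Qed.

Lemma elliptope_coord_cons n (u : Rtuple R n) (x : Rtuple R (offdiag_dim n)) :
  elliptope_coord (cons_coord u x) -> elliptope_coord x /\
  (posdef_coord n x -> quad (invmx (corr_mx x)) u <= 1).
Proof.
rewrite !elliptope_coordE/= corr_mx_cons => -[_ M0 _].
split=> [|pC].
  split; [exact: corr_mxT| |exact: corr_mx_diag] => y.
  have := M0 (row_mx 0%:M y).
  by rewrite quad_block expr0n !mulr0 mul0r !add0r.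
have uC : corr_mx x \in unitmx.
  by rewrite unitmxE unitfE gt_eqF// posdef_det_gt0.
have := M0 (row_mx 1%:M (- (rowt u *m invmx (corr_mx x)))).
rewrite quad_border ?corr_mxT// scale1r addNr !mul0mx [X in _ + X]mxE addr0.
by rewrite expr1n mul1r subr_ge0.
Qed.

(** The rows that border a positive definite matrix to a singular one lie on an
    ellipsoid, and [ge0_integral_quad] turns its measure into that of a
    sphere. *)
Lemma elliptope_boundary_null n :
  lebesgue_tuple R (offdiag_dim n) (@elliptope_coord R n `\` posdef_coord n) = 0%E.
Proof.
elim: n => [|n IH].
  rewrite (_ : _ `\` _ = set0) ?measure0//; apply/seteqP; split=> // x [_]; apply.
  split; first exact: corr_mxT.
  by move=> v /eqP[]; exact: thinmx0.
have mN m : measurable (@elliptope_coord R m `\` posdef_coord m).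
  by apply: measurableD; [exact: measurable_elliptope_coord|
                          exact: measurable_posdef_coord].
have mI : measurable_fun setT (fun x =>
    (\1_(@elliptope_coord R n.+1 `\` posdef_coord n.+1) x : R)%:E).
  by apply/measurable_EFinP; apply: measurable_indic; exact: mN.
rewrite -[X in lebesgue_tuple _ _ X]setIT -(integral_indic _ measurableT (mN _)).
rewrite ge0_integral_coordS//.
rewrite (ge0_negligible_integral (mN n) measurableT _ _ IH)//; last 2 first.
- have := @measurable_fun_fubini_tonelli_G _ _ _ _ R (lebesgue_tuple R n) _
    (measurableT_comp mI (@measurable_cons_coord n)).
  by apply=> z; rewrite lee_fin.
- by move=> x _; apply: integral_ge0.
apply: integral0_eq => x [_ xN].
have [xE|xE] := pselect (elliptope_coord x); last first.
  apply: integral0_eq => u _; rewrite indicE memNset// => -[uE _]; apply: xE.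
  by have [] := elliptope_coord_cons uE.
have pC : posdef_coord n x by apply: contrapT => pC; exact: xN.
have m1 : measurable_fun setT (fun z : R => (\1_[set 1 : R] z : R)%:E).
  by apply/measurable_EFinP; apply: measurable_indic; exact: measurable_set1.
apply/eqP; rewrite eq_le integral_ge0// andbT.
apply: le_trans (_ : (\int[lebesgue_tuple R n]_u
    (\1_[set 1 : R] (quad (invmx (corr_mx x)) u) : R)%:E <= _))%E; last first.
  rewrite (@ge0_integral_quad _ _ _ (fun z => (\1_[set 1 : R] z : R)%:E))//.
    by rewrite integral_sphere mule0.
  exact: posdef_inv.
apply: ge0_le_integral => //.
- apply: (measurableT_comp mI).
  exact: (measurableT_comp (@measurable_cons_coord n) (measurable_pair2 x)).
- by apply: (measurableT_comp m1); exact: measurable_quad.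
- move=> u _; rewrite lee_fin !indicE.
  have [/set_mem[uE uP]|] := boolP (cons_coord u x \in _) => //.
  have [_ /(_ pC) q1] := elliptope_coord_cons uE.
  rewrite mem_set//=; apply/le_anti; rewrite q1/= leNgt; apply/negP => q1'.
  by apply: uP; apply/posdef_coord_cons.
Qed.

End normalizing_constant.
Arguments posdef_coord : clear implicits.

(** * The mean of log det in closed form *)

Section closed_form.
Variable R : realType.

Fixpoint lkj_const (n : nat) (s : R) : R :=
  if n is k.+1 then
    Num.sqrt pi ^+ k * Gamma s / Gamma (s + k%:R / 2) * lkj_const k (s + 2^-1)
  else 1.

Lemma lkj_const_gt0 n s : 0 < s -> 0 < lkj_const n s.
Proof.
elim: n s => //= n IH s s0.
rewrite mulr_gt0 ?IH ?addr_gt0 ?invr_gt0// divr_gt0 ?Gamma_gt0// ?ltr_wpDr//.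
by rewrite mulr_gt0 ?Gamma_gt0// exprn_gt0// sqrtr_gt0 pi_gt0.
Qed.

Lemma lkj_integralE n s : 0 < s -> lkj_integral n s = (lkj_const n s)%:E.
Proof.
elim: n s => [|n IH] s s0.
  rewrite /lkj_integral integral_mkcond ge0_integral_tuple0 patchE.
  rewrite mem_set ?det_mx00 ?powR1//.
  by split=> [|v /eqP[]]; [exact: corr_mxT|exact: thinmx0].
rewrite lkj_integralS ball_integralE// IH ?addr_gt0 ?invr_gt0//.
Qed.

Lemma lkj_Z_posdef n (s : R) : lkj_Z n s = lkj_integral n s.
Proof.
have mE := @measurable_elliptope_coord R n.
have mP := @measurable_posdef_coord R n.
have subPE : posdef_coord R n `<=` @elliptope_coord R n.
  by rewrite posdef_coordE => x [].
rewrite /lkj_Z (ge0_negligible_integral (measurableD mE mP) mE)//.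
- rewrite setDD; congr (integral _ _ _).
  by rewrite setIC; exact/setIidl.
- apply: measurable_funTS; apply/measurable_EFinP.
  exact: measurable_det_powR.
- by move=> x _; rewrite lee_fin powR_ge0.
- exact: elliptope_boundary_null.
Qed.

Lemma lkj_ZE n s : 0 < s -> lkj_Z n s = (lkj_const n s)%:E.
Proof. by move=> s0; rewrite lkj_Z_posdef lkj_integralE. Qed.

(** The logarithmic derivative of [lkj_const n]. In the induction over [n] the
    shift of [s] by [2^-1] turns the summand of index [j] into the one of index
    [j.+1] and keeps the argument of the subtracted digamma values. *)
Definition mean_formula n (s : R) : R :=
  \sum_(0 <= j < n) digamma (s + j%:R / 2)
    - n%:R * digamma (s + (n.-1)%:R / 2).

Lemma is_derive_shift_arg (f : R -> R) (a s df : R) :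
  is_derive (s + a) 1 f df -> is_derive s 1 (fun t => f (t + a)) df.
Proof.
move=> H; have H0 : is_derive s 1 (fun t : R => t + a) 1.
  by apply: is_derive_eq; rewrite addr0.
by have := @is_derive1_comp R f (fun t => t + a) s _ _ H H0; rewrite mulr1.
Qed.

Lemma is_derive_Gamma_digamma (s : R) : 0 < s ->
  is_derive s 1 (@Gamma R) (Gamma s * digamma s).
Proof.
move=> s0; rewrite digammaE// mulrC divfK ?gt_eqF ?Gamma_gt0//.
exact: is_derive_Gamma.
Qed.

Lemma is_derive_lkj_const n (s : R) : 0 < s ->
  is_derive s 1 (lkj_const n) (lkj_const n s * mean_formula n s).
Proof.
elim: n s => [|n IH] s s0.
  rewrite /mean_formula big_nil mul0r subr0 mulr0/=.
  exact: is_derive_cst.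
rewrite /=.
have h0 : 0 < (2^-1 : R) by rewrite invr_gt0.
have s20 : 0 < s + 2^-1 by rewrite addr_gt0.
have n0 : 0 <= n%:R / 2 :> R by rewrite divr_ge0.
have sn0 : 0 < s + n%:R / 2 by rewrite ltr_wpDr.
have H1 := is_derive_shift_arg (IH _ s20).
have H2 := is_derive_Gamma_digamma s0.
have H3 := is_derive_shift_arg (is_derive_Gamma_digamma sn0).
have G0 := lt0r_neq0 (Gamma_gt0 sn0).
have H4 : is_derive s 1 (fun t => (Gamma (t + n%:R / 2))^-1)
    (- (Gamma (s + n%:R / 2))^-1 * digamma (s + n%:R / 2)).
  have := is_deriveV (f := fun t : R => Gamma (t + n%:R / 2)) G0 H3.
  move=> H; apply: is_derive_eq; rewrite /GRing.scale/=.
  by field.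
set b := mean_formula n.+1 s.
have -> : b = mean_formula n (s + 2^-1) + digamma s - digamma (s + n%:R / 2).
  rewrite /b /mean_formula big_nat_recl// mul0r addr0/=.
  rewrite (eq_big_nat _ _ (F2 := fun j => digamma (s + 2^-1 + j%:R / 2))); last first.
    by move=> j _; congr digamma; rewrite -natr1; field.
  case: n {IH H1 n0 sn0 H3 G0 H4 b} => [|n].
    by rewrite !big_geq// !mul0r !addr0 !subr0 mul1r; ring.
  rewrite /= (_ : s + 2^-1 + n%:R / 2 = s + n.+1%:R / 2); last first.
    by rewrite -natr1; field.
  rewrite -[n.+2%:R]natr1.
  move: (\sum_(0 <= j < _) _) (digamma s) (digamma (s + _)) => *.
  by ring.
apply: is_derive_eq; rewrite /GRing.scale/=.
move: (mean_formula n _) (lkj_const n _) (digamma s) (digamma (s + _)) (Gamma s).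
move: (Gamma (s + _)) G0 (Num.sqrt pi ^+ n) => *.
by field.
Qed.

Section mean_laplace.
Variable n : nat.
Notation lam := (lebesgue_tuple R (offdiag_dim n)).
Notation P := (posdef_coord R n).

(** With this weight the normalizing constant is the Laplace transform of
    [logdet], as [\det C `^ (s - 1)] is [expR (s * logdet C) * inv_det C]. *)
Definition inv_det (x : Rtuple R (offdiag_dim n)) : R :=
  \det (corr_mx x) `^ (- 1).

Lemma posdef_coord_det x : P x -> 0 < \det (corr_mx x).
Proof. by rewrite posdef_coordE => -[]. Qed.

Lemma det_powRE (s : R) x : P x ->
  \det (corr_mx x) `^ (s - 1) = expR (s * logdet x) * inv_det x.
Proof.
move=> /posdef_coord_det d0.
by rewrite /inv_det /powR gt_eqF// mulrDl expRD.
Qed.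

Lemma measurable_logdet : measurable_fun setT (@logdet R n).
Proof.
apply: (measurableT_comp (@measurable_ln R)).
exact: measurable_det_corr_mx.
Qed.

Lemma measurable_inv_det : measurable_fun setT inv_det.
Proof.
apply: (measurableT_comp (measurable_powR (- 1))).
exact: measurable_det_corr_mx.
Qed.

Let mP := @measurable_posdef_coord R n.
Let mh : measurable_fun P (@logdet R n) := measurable_funTS measurable_logdet.
Let mv : measurable_fun P inv_det := measurable_funTS measurable_inv_det.

Lemma lkj_laplace_integrable : laplace_integrable lam P (@logdet R n) inv_det.
Proof.
move=> s s0; apply/integrableP; split.
  apply/measurable_EFinP; apply: measurable_funM; last exact: mv.
  by apply: measurableT_comp => //; apply: measurable_funM => //; exact: mh.
rewrite (eq_integral (fun x => (\det (corr_mx x) `^ (s - 1))%:E)).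
  by rewrite -/(lkj_integral n s) lkj_integralE// ltry.
move=> x /set_mem Px; rewrite /= -det_powRE// ger0_norm//; exact: powR_ge0.
Qed.

Lemma lkj_laplaceE s : 0 < s ->
  laplace lam P (@logdet R n) inv_det s = lkj_const n s.
Proof.
move=> s0; transitivity (fine (lkj_integral n s)); last by rewrite lkj_integralE.
by congr fine; apply: eq_integral => x /set_mem Px; rewrite -det_powRE.
Qed.

(** The mean of [logdet] is the logarithmic derivative of the normalizing
    constant, differentiated under the integral sign on one side and in closed
    form on the other. *)
Lemma lkj_laplace'E s : 0 < s ->
  laplace lam P (@logdet R n) (fun x => logdet x * inv_det x) s =
  lkj_const n s * mean_formula n s.
Proof.
move=> s0.
have H1 := is_derive_laplace mP mh mv lkj_laplace_integrable s0.
have H2 := is_derive_lkj_const n s0.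
have H3 : is_derive s 1 (laplace lam P (@logdet R n) inv_det)
    (lkj_const n s * mean_formula n s).
  apply: near_eq_is_derive H2; near=> t.
  by rewrite lkj_laplaceE//; near: t; exact: lt_nbhsr.
by have [_ <-] := H1; have [_ <-] := H3.
Unshelve. all: by end_near. Qed.

Lemma mean_formulaE s : 0 < s -> mean_formula n s =
  laplace lam P (@logdet R n) (fun x => logdet x * inv_det x) s /
  laplace lam P (@logdet R n) inv_det s.
Proof.
move=> s0; rewrite lkj_laplace'E// lkj_laplaceE// mulrAC mulfV ?mul1r//.
by rewrite gt_eqF// lkj_const_gt0.
Qed.

Let v0 x : P x -> 0 <= inv_det x. Proof. by move=> _; exact: powR_ge0. Qed.

Let F0 s : 0 < s -> 0 < laplace lam P (@logdet R n) inv_det s.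
Proof. by move=> s0; rewrite lkj_laplaceE// lkj_const_gt0. Qed.

Lemma mean_formula_le s t : 0 < s -> s <= t ->
  mean_formula n s <= mean_formula n t.
Proof.
move=> s0 st.
rewrite (mean_formulaE s0) (mean_formulaE (lt_le_trans s0 st)).
exact: (laplace_logderiv_le mP mh mv v0 lkj_laplace_integrable F0).
Qed.

Lemma mean_formula_eq a b s : 0 < a -> a < b -> 0 < s ->
  mean_formula n a = mean_formula n b -> mean_formula n s = mean_formula n a.
Proof.
move=> a0 ab s0.
rewrite (mean_formulaE a0) (mean_formulaE s0) (mean_formulaE (lt_trans a0 ab)).
exact: (laplace_logderiv_eq mP mh mv v0 lkj_laplace_integrable F0).
Qed.

Lemma continuous_mean_formula s :
  0 < s -> {for s, continuous (mean_formula n)}.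
Proof.
move=> s0.
have iw := laplace_integrableM mP mh mv lkj_laplace_integrable.
have mw : measurable_fun P (fun x => logdet x * inv_det x).
  exact: measurable_funM.
have c1 : {for s, continuous (laplace lam P (@logdet R n) inv_det)}.
  apply: differentiable_continuous; apply/derivable1_diffP.
  by have [] := is_derive_laplace mP mh mv lkj_laplace_integrable s0.
have c2 : {for s, continuous
    (laplace lam P (@logdet R n) (fun x => logdet x * inv_det x))}.
  apply: differentiable_continuous; apply/derivable1_diffP.
  by have [] := is_derive_laplace mP mh mw iw s0.
have : laplace lam P (@logdet R n) (fun x => logdet x * inv_det x) t /
    laplace lam P (@logdet R n) inv_det t @[t --> s] --> mean_formula n s.
  rewrite (mean_formulaE s0); apply: cvgM; first exact: c2.
  by apply: cvgV; [rewrite gt_eqF// F0|exact: c1].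
apply: cvg_trans.
apply: near_eq_cvg; near=> t; apply/esym/mean_formulaE.
by near: t; exact: lt_nbhsr.
Unshelve. all: by end_near. Qed.

End mean_laplace.

Section mean_limits.
Variable k : nat.
Notation n := k.+2.

Lemma mean_formula_sum (s : R) : mean_formula n s = \sum_(0 <= j < n)
  (digamma (s + j%:R / 2) - digamma (s + (n.-1)%:R / 2)).
Proof.
rewrite /mean_formula sumrB; congr (_ - _).
by rewrite big_const_nat subn0 iter_addr_0 mulr_natl.
Qed.

Let term_le0 (s : R) j : 0 < s -> (j < n)%N ->
  digamma (s + j%:R / 2) - digamma (s + (n.-1)%:R / 2) <= 0.
Proof.
move=> s0 jn; rewrite subr_le0; apply: digamma_le.
  by rewrite ltr_wpDr// divr_ge0.
by rewrite lerD2l ler_wpM2r// ler_nat.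
Qed.

Let K : R := (Num.truncn ((n.-1)%:R / 2 : R)).+1%:R.

Lemma mean_formula_le0 (s : R) : 0 < s -> mean_formula n s <= 0.
Proof.
move=> s0; rewrite mean_formula_sum big_nat; apply: sumr_le0 => j /andP[_ jn].
exact: term_le0.
Qed.

Lemma mean_formula_ge (s : R) : 0 < s -> - (n%:R * (K / s)) <= mean_formula n s.
Proof.
move=> s0; rewrite mean_formula_sum big_nat.
have -> : - (n%:R * (K / s)) = \sum_(0 <= j < n | (0 <= j < n)%N) - (K / s).
  by rewrite -big_nat big_const_nat subn0 iter_addr_0 mulr_natl mulNrn.
apply: ler_sum => j /andP[_ jn].
have j0 : 0 <= j%:R / 2 :> R by rewrite divr_ge0.
have n0 : 0 <= (n.-1)%:R / 2 :> R by rewrite divr_ge0.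
have /andP[H1 _] := digamma_add_le s0 j0.
have /andP[_ H2] := digamma_add_le s0 n0.
by rewrite -/K in H2; rewrite lerNl opprB lerBlDr (le_trans H2)// addrC lerD2l.
Qed.

Let ub_arith (a b c d e S : R) : a + e <= b -> c <= d -> S <= 0 ->
  a - d + S <= b - c - e.
Proof. by lra. Qed.

(** The summand of index [0] contains [digamma s = digamma (s + 1) - s^-1]; the
    others are nonpositive. *)
Lemma mean_formula_ub (s : R) : 0 < s -> s <= 1 ->
  mean_formula n s <= digamma 2 - digamma ((n.-1)%:R / 2) - s^-1.
Proof.
move=> s0 s1; rewrite mean_formula_sum big_nat_recl// mul0r addr0.
have n0 : 0 < (n.-1)%:R / 2 :> R by rewrite divr_gt0.
have H1 : digamma (s + 1) <= digamma 2.
  by apply: digamma_le; [rewrite addr_gt0|lra].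
have H2 : digamma ((n.-1)%:R / 2) <= digamma (s + (n.-1)%:R / 2).
  by apply: digamma_le => //; rewrite lerDr ltW.
rewrite digammaD1// in H1.
have H3 : \sum_(0 <= i < k.+1)
    (digamma (s + i.+1%:R / 2) - digamma (s + (n.-1)%:R / 2)) <= 0.
  rewrite big_nat; apply: sumr_le0 => j /andP[_ jn].
  exact: term_le0.
exact: ub_arith H1 H2 H3.
Qed.

Lemma cvg_mean_formula_pinfty : mean_formula n (x : R) @[x --> +oo] --> (0 : R).
Proof.
apply/cvgrPdist_le => e e0; near=> x.
have x0 : 0 < x by near: x; apply: nbhs_pinfty_gt; rewrite num_real.
have xe : n%:R * K / e <= x.
  by near: x; apply: nbhs_pinfty_ge; rewrite num_real.
rewrite sub0r normrN ler0_norm ?mean_formula_le0//.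
have := mean_formula_ge x0; rewrite lerNl => /le_trans; apply.
by rewrite mulrA ler_pdivrMr// [e * x]mulrC -ler_pdivrMr.
Unshelve. all: by end_near. Qed.

Let norm_arith (C A y : R) : `|C - A| + 1 <= y -> C - y <= A.
Proof. by move=> H; have := ler_norm (C - A); lra. Qed.

Lemma cvg_mean_formula_0 : mean_formula n x @[x --> (0 : R)^'+] --> -oo.
Proof.
pose C : R := digamma 2 - digamma ((n.-1)%:R / 2).
apply/cvgrNyPle => A; near=> x.
have x0 : 0 < x by [].
have x1 : x <= 1 by near: x; apply: nbhs_right_le.
apply: le_trans (mean_formula_ub x0 x1) _; rewrite -/C.
have : x <= (`|C - A| + 1)^-1.
  by near: x; apply: nbhs_right_le; rewrite invr_gt0 ltr_wpDl.
rewrite -[leLHS]invrK lef_pV2 ?posrE ?invr_gt0 ?ltr_wpDl//.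
exact: norm_arith.
Unshelve. all: by end_near. Qed.

Let norm_arith_lt (C m : R) : ~ (m <= C - (`|C - m| + 1)).
Proof. by move=> H; have := ler_norm (C - m); lra. Qed.

(** If two values coincide then [mean_formula n] is constant on the positive
    half-line by [mean_formula_eq], although it is unbounded below near [0]. *)
Lemma mean_formula_lt (s t : R) : 0 < s -> s < t ->
  mean_formula n s < mean_formula n t.
Proof.
move=> s0 st; rewrite lt_neqAle mean_formula_le ?ltW// andbT; apply/eqP => E.
pose C : R := digamma 2 - digamma ((n.-1)%:R / 2).
pose y : R := `|C - mean_formula n s| + 1.
have y1 : 1 <= y by rewrite lerDr.
have y0 : 0 < y by exact: lt_le_trans y1.
have x0 : 0 < y^-1 by rewrite invr_gt0.
have x1 : y^-1 <= 1 by rewrite invf_le1.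
have := mean_formula_ub x0 x1.
rewrite (mean_formula_eq s0 st x0 E) invrK -/C /y.
exact: norm_arith_lt.
Qed.

End mean_limits.
End closed_form.

(** * Integration against a probability with a density *)

Section density_integrals.
Context d (T : measurableType d) (R : realType).
Variables (mu : {sigma_finite_measure set T -> \bar R}) (P : probability T R).
Variable f : T -> R.
Hypotheses (mf : measurable_fun setT f) (f0 : forall x, 0 <= f x)
  (Pf : forall A, measurable A -> P A = (\int[mu]_(x in A) (f x)%:E)%E).
Local Open Scope ereal_scope.

Lemma density_integrable : mu.-integrable setT (EFin \o f).
Proof.
apply/integrableP; split; first exact/measurable_EFinP.
rewrite (eq_integral (EFin \o f)); last first.
  by move=> x _ /=; rewrite ger0_norm.
by rewrite -Pf// probability_setT ltry.
Qed.

(** The density is almost everywhere the Radon-Nikodym derivative of [P]. *)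
Lemma ge0_integral_density (g : T -> \bar R) : measurable_fun setT g ->
  (forall x, 0 <= g x) -> \int[P]_x g x = \int[mu]_x (g x * (f x)%:E).
Proof.
move=> mg g0.
have Pmu : P `<< mu.
  apply/null_content_dominatesP => A mA muA; rewrite Pf//.
  apply: null_set_integral => //.
  by apply/measurable_EFinP; exact: measurable_funTS.
pose r := Radon_Nikodym_SigmaFinite.f P mu.
have ir : mu.-integrable setT r by exact: Radon_Nikodym_SigmaFinite.f_integrable.
have fr : ae_eq mu setT (EFin \o f) r.
  apply: integral_ae_eq => //; first exact: density_integrable.
    exact: measurable_int ir.
  by move=> A _ mA; rewrite -Pf// -Radon_Nikodym_SigmaFinite.f_integral.
rewrite -(Radon_Nikodym_SigmaFinite.change_of_variables Pmu g0 measurableT mg).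
apply: ae_eq_integral => //.
- by apply: emeasurable_funM => //; exact: measurable_int ir.
- by apply: emeasurable_funM => //; exact/measurable_EFinP.
- by apply: filterS fr => x + _ => /(_ I)/= E; rewrite E.
Qed.

(** The positive and negative parts of [h] are treated separately, so the two
    sides agree even when they are infinite. *)
Lemma integral_density (h : T -> R) : measurable_fun setT h ->
  \int[P]_x (h x)%:E = \int[mu]_x (h x * f x)%:E.
Proof.
move=> mh; have mhE : measurable_fun setT (EFin \o h) by exact/measurable_EFinP.
rewrite [LHS]integralE [RHS]integralE; congr (_ - _).
- rewrite (ge0_integral_density (measurable_funepos mhE) (fun=> funepos_ge0 _ _)).
  apply: eq_integral => x _; rewrite !funeposE.
  by rewrite /= -!EFin_max -EFinM maxr_pMl// mul0r.
- rewrite (ge0_integral_density (measurable_funeneg mhE) (fun=> funeneg_ge0 _ _)).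
  apply: eq_integral => x _; rewrite !funenegE.
  by rewrite /= -!EFin_max -EFinM maxr_pMl// mul0r mulNr.
Qed.

Variable S : set T.
Hypotheses (mS : measurable S) (PS : P S = 1).

Lemma density_support : ae_eq mu (~` S) (EFin \o f) (cst 0).
Proof.
have mSC := measurableC mS.
apply: (ae_eq0_ge0_Rintegral mSC) => //.
  exact: (integrableS measurableT mSC (@subsetT _ _) density_integrable).
by rewrite /Rintegral -Pf// probability_setC// PS subee.
Qed.

(** A density vanishes almost everywhere off a set of probability one. *)
Lemma integral_density_support (h : T -> R) : measurable_fun setT h ->
  \int[P]_x (h x)%:E = \int[mu]_(x in S) (h x * f x)%:E.
Proof.
move=> mh; rewrite integral_density// [RHS]integral_mkcond.
have mhf : measurable_fun setT (fun x => (h x * f x)%:E).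
  by apply/measurable_EFinP; exact: measurable_funM.
apply: ae_eq_integral => //.
  by apply/(measurable_restrictT _ _).1 => //; exact: measurable_funTS.
apply: filterS density_support => x H _; rewrite patchE.
case: ifPn => // /negP xS.
have /H [->] : (~` S) x by move=> Sx; apply: xS; rewrite inE.
by rewrite mulr0.
Qed.

End density_integrals.

Lemma ae_eq_density d (T : measurableType d) (R : realType)
    (mu : {sigma_finite_measure set T -> \bar R}) (P : probability T R)
    (f g : T -> R) :
    measurable_fun setT f -> (forall x, 0 <= f x) ->
    (forall A, measurable A -> P A = (\int[mu]_(x in A) (f x)%:E)%E) ->
    measurable_fun setT g ->
    (forall A, measurable A -> P A = (\int[mu]_(x in A) (g x)%:E)%E) ->
  ae_eq mu setT (EFin \o f) (EFin \o g).
Proof.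
move=> mf f0 Pf mg Pg; apply: integral_ae_eq => //.
- exact: density_integrable Pf.
- exact/measurable_EFinP.
- by move=> A _ mA; rewrite -Pf// Pg.
Qed.

(** The negative part of [f] is dominated by that of [g]. *)
Lemma integral_pinfty_or_integrable d (T : measurableType d) (R : realType)
    (mu : {measure set T -> \bar R}) (D : set T) (f g : T -> R) :
    measurable D -> measurable_fun D f -> mu.-integrable D (EFin \o g) ->
    (forall x, D x -> g x <= f x) ->
  (\int[mu]_(x in D) (f x)%:E = +oo)%E \/ mu.-integrable D (EFin \o f).
Proof.
move=> mD mf ig gf.
have mfE : measurable_fun D (EFin \o f) by exact/measurable_EFinP.
have mfp : measurable_fun D ((EFin \o f)^\+)%E by exact: measurable_funepos.
have mfn : measurable_fun D ((EFin \o f)^\-)%E by exact: measurable_funeneg.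
have nfoo : (\int[mu]_(x in D) (EFin \o f)^\- x < +oo)%E.
  apply: le_lt_trans (integral_funeneg_lt_pinfty mD ig).
  apply: ge0_le_integral => //.
    by apply: measurable_funeneg; exact: measurable_int ig.
  move=> x Dx; rewrite !funenegE/= -!EFin_max lee_fin.
  by rewrite ge_max le_max lerN2 gf//= le_max lexx orbT.
have n0 : (0 <= \int[mu]_(x in D) (EFin \o f)^\- x)%E by exact: integral_ge0.
have [poo|] := eqVneq (\int[mu]_(x in D) (EFin \o f)^\+ x)%E +oo%E.
  left; rewrite [LHS]integralE [X in (X - _)%E]poo.
  by rewrite addye// eqe_oppLR/= lt_eqF.
rewrite -ltey => poo; right; apply/integrableP; split => //.
rewrite (eq_integral ((EFin \o f)^\+ \+ (EFin \o f)^\-)%E); last first.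
  by move=> x _; exact: (congr1 (fun g => g x) (fune_abse (EFin \o f))).
by rewrite ge0_integralD//= lte_add_pinfty.
Qed.

(** * The LKJ distribution and the entropy *)

Section lkj_distribution.
Variables (R : realType) (n : nat).
Notation T := (Rtuple R (offdiag_dim n)).
Notation lam := (lebesgue_tuple R (offdiag_dim n)).
Notation E := (@elliptope_coord R n).
Notation P := (posdef_coord R n).

Let mE : measurable E := @measurable_elliptope_coord R n.
Let mP : measurable P := @measurable_posdef_coord R n.

Lemma measurable_lkj_density eta : measurable_fun setT (@lkj_density R n eta).
Proof.
apply: measurable_funM; last exact: measurable_indic.
by apply: measurable_funM => //; exact: measurable_det_powR.
Qed.

Section fixed_eta.
Variables (eta : R) (eta0 : 0 < eta).

Lemma fine_lkj_Z : fine (lkj_Z n eta) = lkj_const n eta.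
Proof. by rewrite lkj_ZE. Qed.

Lemma lkj_density_ge0 (x : T) : 0 <= lkj_density eta x :> R.
Proof.
rewrite /lkj_density fine_lkj_Z mulr_ge0// mulr_ge0 ?powR_ge0//.
by rewrite invr_ge0 ltW// lkj_const_gt0.
Qed.

Lemma posdef_coord_sub : P `<=` E.
Proof. by rewrite posdef_coordE => x []. Qed.

Lemma lkj_densityE (x : T) : P x ->
  lkj_density eta x = (lkj_const n eta)^-1 * \det (corr_mx x) `^ (eta - 1).
Proof.
move=> Px; rewrite /lkj_density fine_lkj_Z indicE mem_set ?mulr1//.
exact: posdef_coord_sub.
Qed.

Lemma LKJ_weight A : LKJ n eta A = (lkj_weight eta A * (lkj_const n eta)^-1%:E)%E.
Proof.
have wT : lkj_weight eta [set: T] = (lkj_const n eta)%:E.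
  by rewrite -lkj_ZE// /lkj_weight setTI.
rewrite [LHS]/(mnormalize _ _ _) /mnormalize.
case: ifPn => [/orP[/eqP w0|/eqP w0]|_].
- have [Z0] := etrans (esym wT) w0.
  by have := lkj_const_gt0 n eta0; rewrite Z0 ltxx.
- by have := etrans (esym wT) w0.
- by congr (_ * (_^-1)%:E)%E; exact: (congr1 fine wT).
Qed.

Lemma LKJ_density : is_density (LKJ n eta) (lkj_density eta).
Proof.
split; [exact: measurable_lkj_density|exact: lkj_density_ge0|move=> A mA].
rewrite LKJ_weight /lkj_weight integral_mkcondr muleC -ge0_integralZl//.
- apply: eq_integral => x _; rewrite patchE /lkj_density fine_lkj_Z indicE.
  by case: ifP => _; rewrite ?mulr1 ?mulr0 ?mule0 ?EFinM.
- apply: measurable_funTS; apply/(measurable_restrictT _ _).1; first exact: mE.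
  apply/measurable_EFinP; apply: measurable_funTS.
  exact: measurable_det_powR.
- by move=> x _; rewrite patchE; case: ifP => // _; rewrite lee_fin powR_ge0.
- by rewrite lee_fin invr_ge0 ltW// lkj_const_gt0.
Qed.

Lemma LKJ_elliptope : elliptope_probs (LKJ n eta).
Proof.
split; last by exists (lkj_density eta); exact: LKJ_density.
rewrite LKJ_weight /lkj_weight setIid -/(lkj_Z n eta) lkj_ZE//.
by rewrite -EFinM mulfV// gt_eqF// lkj_const_gt0.
Qed.

End fixed_eta.

Lemma elliptope_probs_posdef (Q : probability T R) : elliptope_probs Q -> Q P = 1%E.
Proof.
move=> [QE [f [mf f0 Qf]]].
have mN : measurable (E `\` P) by exact: measurableD.
have QN : Q (E `\` P) = 0%E.
  rewrite Qf// null_set_integral//; last exact: elliptope_boundary_null.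
  by apply/measurable_EFinP; exact: measurable_funTS.
have EP : E = P `|` (E `\` P) by rewrite setDUK//; exact: posdef_coord_sub.
rewrite -QE [in RHS]EP measureU//; first by rewrite [X in (_ + X)%E]QN adde0.
by apply/seteqP; split=> // x [Px []].
Qed.

Lemma LKJ_mean (eta : R) : 0 < eta ->
  ('E_(LKJ n eta)[@logdet R n] = (mean_formula n eta)%:E)%E.
Proof.
move=> eta0; rewrite unlock.
have [mg g0 Lg] := LKJ_density eta0.
have mlog := @measurable_logdet R n.
rewrite (integral_density_support mg g0 Lg mP _ mlog); last first.
  exact/elliptope_probs_posdef/LKJ_elliptope.
have iw := laplace_integrableM mP (measurable_funTS mlog)
  (measurable_funTS (@measurable_inv_det R n)) (@lkj_laplace_integrable R n) eta0.
transitivity (\int[lam]_(x in P) ((lkj_const n eta)^-1%:E *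
    (expR (eta * logdet x) * (logdet x * inv_det x))%:E))%E.
  apply: eq_integral => x /set_mem Px; rewrite lkj_densityE// det_powRE// -EFinM.
  by congr EFin; ring.
rewrite integralZl// -(fineK (integrable_fin_num mP iw)).
rewrite -[fine _]/(laplace _ _ _ _ _) lkj_laplace'E// -EFinM mulKf//.
by rewrite gt_eqF// lkj_const_gt0.
Qed.

Lemma mean_logdetE (eta : R) : 0 < eta -> mean_logdet n eta = mean_formula n eta.
Proof. by move=> eta0; rewrite /mean_logdet LKJ_mean. Qed.

Let measurable_xlnx (f : T -> R) : measurable_fun setT f ->
  measurable_fun setT (fun x => (f x * ln (f x))%:E).
Proof.
move=> mf; apply/measurable_EFinP; apply: measurable_funM => //.
exact: (measurableT_comp (@measurable_ln R)).
Qed.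

Lemma entropyE (Q : probability T R) (f : T -> R) : is_density Q f ->
  entropy Q = (- \int[lam]_(x in E) (f x * ln (f x))%:E)%E.
Proof.
move=> dQ; have [mf f0 Qf] := dQ.
have [mg g0 Qg] : is_density Q (density Q) by apply: xgetPex; exists f.
rewrite /entropy; congr (- _)%E; apply: ae_eq_integral => //.
- by apply: measurable_funTS; exact: measurable_xlnx.
- by apply: measurable_funTS; exact: measurable_xlnx.
have := ae_eq_density mg g0 Qg mf Qf.
by apply: filterS => x /(_ I)[] ->.
Qed.

Lemma entropy_expectation (Q : probability T R) (f : T -> R) :
  elliptope_probs Q -> is_density Q f ->
  entropy Q = (- 'E_Q[fun x => ln (f x)])%E.
Proof.
move=> [QE _] dQ; have [mf f0 Qf] := dQ.
rewrite (entropyE dQ) unlock; congr (- _)%E.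
rewrite (integral_density_support mf f0 Qf mE QE); last first.
  exact: (measurableT_comp (@measurable_ln R)).
by apply: eq_integral => x _; rewrite mulrC.
Qed.

Lemma entropy_posdef (Q : probability T R) (f : T -> R) :
  elliptope_probs Q -> is_density Q f ->
  entropy Q = (- \int[lam]_(x in P) (f x * ln (f x))%:E)%E.
Proof.
move=> QE dQ; have [mf f0 Qf] := dQ.
rewrite (entropy_expectation QE dQ) unlock; congr (- _)%E.
rewrite (integral_density_support mf f0 Qf mP (elliptope_probs_posdef QE)); last first.
  exact: (measurableT_comp (@measurable_ln R)).
by apply: eq_integral => x _; rewrite mulrC.
Qed.

End lkj_distribution.

(** * The Gibbs inequality *)

Section gibbs.
Variable R : realType.

(** This is [1 + y < expR y] at [y = ln (b / a)], multiplied by [a]. *)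
Lemma gibbs_lt (a b : R) : 0 <= a -> 0 < b -> a != b ->
  a * ln b + (a - b) < a * ln a.
Proof.
move=> a0 b0 ab; have [->|a0'] := eqVneq a 0.
  by rewrite !mul0r add0r sub0r oppr_lt0.
have {a0'} a0' : 0 < a by rewrite lt0r a0' a0.
have ba : 0 < b / a by rewrite divr_gt0.
have : 1 + ln (b / a) < expR (ln (b / a)).
  apply: expR_gt1Dx; rewrite ln_eq0//; apply: contra ab => /eqP h.
  by rewrite eq_sym -[b](divfK (lt0r_neq0 a0')) h mul1r.
rewrite lnK ?posrE// ltr_pdivlMr// ln_div ?posrE// => H.
by rewrite -subr_gt0; rewrite -subr_gt0 in H; congr (0 < _): H; ring.
Qed.

Lemma gibbs_le (a b : R) : 0 <= a -> 0 < b -> a * ln b + (a - b) <= a * ln a.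
Proof.
move=> a0 b0; have [->|ab] := eqVneq a b; first by rewrite subrr addr0.
by rewrite ltW// gibbs_lt.
Qed.

Variable n : nat.
Notation T := (Rtuple R (offdiag_dim n)).
Notation lam := (lebesgue_tuple R (offdiag_dim n)).
Notation P := (posdef_coord R n).

Let mP : measurable P := @measurable_posdef_coord R n.

Variables (eta : R) (eta0 : 0 < eta).
Let Z := lkj_const n eta.
Let Z0 : 0 < Z := lkj_const_gt0 n eta0.
Let g : T -> R := lkj_density eta.
(** The logarithm of [g], affine in [logdet]: its mean under [Q] depends on [Q]
    only through the mean of [(eta - 1) * logdet]. *)
Let logg (x : T) : R := - ln Z + (eta - 1) * logdet x.

Lemma ln_lkj_density x : P x -> ln (g x) = logg x.
Proof.
move=> Px; have d0 := posdef_coord_det Px.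
rewrite /g lkj_densityE// lnM ?posrE ?invr_gt0 ?powR_gt0//.
by rewrite lnV ?posrE// ln_powR.
Qed.

Let g_gt0 x : P x -> 0 < g x.
Proof.
move=> Px; rewrite /g lkj_densityE// mulr_gt0 ?invr_gt0// powR_gt0//.
exact: posdef_coord_det.
Qed.

Section one_distribution.
Variables (Q : probability T R) (f : T -> R).
Hypotheses (QE : elliptope_probs Q) (dQ : is_density Q f).
Variable m : R.
Hypothesis Qm :
  (\int[Q]_x ((eta - 1) * logdet x)%:E = ((eta - 1) * m)%:E)%E.

(** [gibbs_le] reads [G x <= F x] on [P]. *)
Let F x := f x * ln (f x).
Let G x := f x * logg x + (f x - g x).
Let c := ln Z - (eta - 1) * m.

Let mf : measurable_fun setT f. Proof. by case: dQ. Qed.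
Let f0 x : 0 <= f x. Proof. by case: dQ. Qed.
Let Qf A : measurable A -> Q A = (\int[lam]_(x in A) (f x)%:E)%E.
Proof. by case: dQ => _ _; apply. Qed.
Let QP := elliptope_probs_posdef QE.

Let mlogg : measurable_fun setT logg.
Proof.
apply: measurable_funD => //; apply: measurable_funM => //.
exact: measurable_logdet.
Qed.

Let mass1 (Q' : probability T R) f' : is_density Q' f' -> Q' P = 1%E ->
  lam.-integrable P (EFin \o f') /\ \int[lam]_(x in P) f' x = 1.
Proof.
move=> [mf' f0' Qf'] Q'P; split.
  apply: (integrableS measurableT mP (@subsetT _ _)).
  exact: density_integrable mf' f0' Qf'.
by rewrite /Rintegral -Qf'// Q'P.
Qed.

Let integral_logg : lam.-integrable P (EFin \o (fun x => f x * logg x)) /\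
  \int[lam]_(x in P) (f x * logg x) = - c.
Proof.
have mlog := @measurable_logdet R n.
have ml : measurable_fun setT (fun x : T => (eta - 1) * logdet x).
  exact: measurable_funM.
have i1 : Q.-integrable setT (EFin \o (fun x : T => (eta - 1) * logdet x)).
  apply/integrableP; split; first exact/measurable_EFinP.
  by have := integral_fin_num_abs Q measurableT ml; rewrite Qm => ->.
have i0 : Q.-integrable setT (EFin \o (fun x : T => - ln Z)).
  exact: finite_measure_integrable_cst.
have E : (\int[lam]_(x in P) (f x * logg x)%:E = (- c)%:E)%E.
  have := integral_density_support mf f0 Qf mP QP mlogg.
  rewrite [in LHS]integralD_EFin// integral_cst// [X in (_ * X)%E]probability_setT.
  rewrite Qm mule1 -EFinD => H.
  rewrite /c opprB addrC H; apply: eq_integral => x _.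
  by rewrite mulrC.
split; last by rewrite /Rintegral E.
have mfl : measurable_fun P (fun x => f x * logg x).
  by apply: measurable_funTS; exact: measurable_funM.
apply/integrableP; split; first exact/measurable_EFinP.
by have := integral_fin_num_abs lam mP mfl; rewrite E => ->.
Qed.

Let integral_G : lam.-integrable P (EFin \o G) /\ \int[lam]_(x in P) G x = - c.
Proof.
have [i1 E1] := integral_logg.
have [i2 E2] := mass1 dQ QP.
have [i3 E3] := mass1 (LKJ_density n eta0)
  (elliptope_probs_posdef (LKJ_elliptope n eta0)).
have i23 : lam.-integrable P (EFin \o (fun x => f x - g x)).
  by have := integrableB mP i2 i3; apply: eq_integrable => // x _.
split.
  by have := integrableD mP i1 i23; apply: eq_integrable => // x _.
by rewrite /G RintegralD// RintegralB// E1 E2 E3 subrr addr0.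
Qed.

Let mF : measurable_fun P F.
Proof.
apply: measurable_funTS; apply: measurable_funM => //.
exact: (measurableT_comp (@measurable_ln R)).
Qed.

Let GF x : P x -> G x <= F x.
Proof. by move=> Px; rewrite /G /F -ln_lkj_density// gibbs_le// g_gt0. Qed.

(** Integrate [gibbs_le] for the densities of [Q] and of the LKJ distribution;
    the difference of the two masses vanishes. When [f * ln f] is not integrable
    its integral is [+oo] and the entropy is [-oo]. *)
Lemma entropy_le : (entropy Q <= c%:E)%E.
Proof.
rewrite (entropy_posdef QE dQ).
have [iG EG] := integral_G.
have [->|iF] := integral_pinfty_or_integrable mP mF iG GF.
  by rewrite leNye.
rewrite leeNl -EFinN -EG fineK ?(integrable_fin_num mP iG)//.
apply: (le_integral mP iG iF) => x /set_mem Px.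
by rewrite lee_fin GF.
Qed.

(** Equality in the integrated Gibbs inequality forces [f = g] almost
    everywhere. *)
Lemma entropy_eq :
  entropy Q = c%:E -> forall A, measurable A -> Q A = LKJ n eta A.
Proof.
rewrite (entropy_posdef QE dQ) => Ec.
have [iG EG] := integral_G.
have EF : (\int[lam]_(x in P) (F x)%:E = (- c)%:E)%E.
  by rewrite EFinN -Ec oppeK.
have iF : lam.-integrable P (EFin \o F).
  by have [h|//] := integral_pinfty_or_integrable mP mF iG GF; rewrite h in EF.
have iFG : lam.-integrable P (EFin \o (fun x => F x - G x)).
  by have := integrableB mP iF iG; apply: eq_integrable => // x _.
have E0 : \int[lam]_(x in P) (F x - G x) = 0.
  by rewrite RintegralB// EG /Rintegral EF/= subrr.
have FG0 x : P x -> 0 <= F x - G x by move=> Px; rewrite subr_ge0 GF.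
have ae0 := ae_eq0_ge0_Rintegral mP iFG FG0 E0.
have [mg g0 Lg] := LKJ_density n eta0.
have LP := elliptope_probs_posdef (LKJ_elliptope n eta0).
move=> A mA.
have QA (Q' : probability T R) : Q' A = (\int[Q']_x (\1_A x)%:E)%E.
  by rewrite integral_indic ?setIT.
rewrite !QA.
have m1 : measurable_fun setT (\1_A : T -> R) by exact: measurable_indic.
rewrite (integral_density_support mf f0 Qf mP QP m1).
rewrite (integral_density_support mg g0 Lg mP LP m1).
apply: ae_eq_integral => //.
- apply: measurable_funTS; apply/measurable_EFinP.
  exact: (measurable_funM m1 mf).
- apply: measurable_funTS; apply/measurable_EFinP.
  exact: (measurable_funM m1 mg).
apply: filterS ae0 => x + Px => /(_ Px)[/eqP].
rewrite subr_eq0 => /eqP FGx; congr (_ * _)%:E.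
apply/eqP/negPn/negP => fg; have := gibbs_lt (f0 x) (g_gt0 Px) fg.
by rewrite ln_lkj_density// -/(G x) -/(F x) FGx ltxx.
Qed.

Lemma entropy_self : (forall x, P x -> f x = g x) -> entropy Q = c%:E.
Proof.
move=> fg; rewrite (entropy_posdef QE dQ).
have [iG EG] := integral_G.
rewrite -[c]opprK -EG EFinN; congr (- _)%E.
rewrite fineK ?(integrable_fin_num mP iG)//.
apply: eq_integral => x /set_mem Px.
by rewrite /G fg// subrr addr0 ln_lkj_density.
Qed.

End one_distribution.

Lemma entropy_LKJ (m : R) :
  (\int[LKJ n eta]_x ((eta - 1) * logdet x)%:E = ((eta - 1) * m)%:E)%E ->
  entropy (LKJ n eta) = (ln Z - (eta - 1) * m)%:E.
Proof.
move=> Lm.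
exact: (entropy_self (LKJ_elliptope n eta0) (LKJ_density n eta0) Lm).
Qed.

End gibbs.

(** * Maximum entropy and the inversion of the mean *)

Section conclusions.
Variables (R : realType) (k : nat).
Notation n := k.+2.
Notation lam := (lebesgue_tuple R (offdiag_dim n)).

Lemma integral_scaled_logdet (Q : probability (Rtuple R (offdiag_dim n)) R)
    (a m : R) :
  ('E_Q[@logdet R n] = m%:E)%E ->
  (\int[Q]_x (a * logdet x)%:E = (a * m)%:E)%E.
Proof.
rewrite unlock => Em.
have ml := @measurable_logdet R n.
have il : Q.-integrable setT (EFin \o @logdet R n).
  apply/integrableP; split; first exact/measurable_EFinP.
  by have := integral_fin_num_abs Q measurableT ml; rewrite Em => ->.
transitivity (\int[Q]_x (a%:E * (logdet x)%:E))%E; first exact: eq_integral.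
by rewrite integralZl// Em.
Qed.

(** The hypothesis constrains the mean of [(eta - 1) * logdet] rather than that
    of [logdet], so that it covers the unconstrained problem at [eta = 1]. *)
Lemma unique_maximizer_LKJ (eta m : R)
    (S : set (probability (Rtuple R (offdiag_dim n)) R)) :
    0 < eta -> S `<=` @elliptope_probs R n -> S (LKJ n eta) ->
    (forall Q, S Q -> \int[Q]_x ((eta - 1) * logdet x)%:E = ((eta - 1) * m)%:E)%E ->
  unique_maximizer (@entropy R n) S (LKJ n eta).
Proof.
move=> eta0 SE SL Sm.
have EL := entropy_LKJ eta0 (Sm _ SL).
split=> [//|Q SQ|Q SQ Qmax].
  have QE := SE _ SQ; have [_ [f dQ]] := QE.
  by rewrite EL; apply: (entropy_le eta0 QE dQ); exact: Sm.
have QE := SE _ SQ; have [_ [f dQ]] := QE.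
apply: (entropy_eq eta0 QE dQ (Sm _ SQ)).
apply/eqP; rewrite eq_le (entropy_le eta0 QE dQ (Sm _ SQ))/= -EL.
exact: Qmax.
Qed.

Lemma near_mean_logdetE (x : R) : 0 < x ->
  {near x, mean_formula n =1 @mean_logdet R n}.
Proof.
move=> x0; near=> y; rewrite mean_logdetE//.
by near: y; exact: lt_nbhsr.
Unshelve. all: by end_near. Qed.

Lemma mean_logdet_continuous : {within `]0, +oo[, continuous (@mean_logdet R n)}.
Proof.
apply: continuous_in_subspaceT => x /set_mem/=; rewrite in_itv/= andbT => x0.
have H : mean_formula n y @[y --> x] --> mean_formula n x.
  exact: continuous_mean_formula.
rewrite -(mean_logdetE n x0) in H; apply: cvg_trans H.
by apply: near_eq_cvg; exact: near_mean_logdetE.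
Qed.

Lemma mean_logdet_lt : {in `]0, +oo[ &, {homo (@mean_logdet R n) : x y / x < y}}.
Proof.
move=> x y; rewrite !in_itv/= !andbT => x0 y0 xy.
by rewrite !mean_logdetE// mean_formula_lt.
Qed.

Lemma mean_logdet_cvg0 : mean_logdet n x @[x --> (0 : R)^'+] --> -oo.
Proof.
apply: cvg_trans (@cvg_mean_formula_0 R k).
by apply: near_eq_cvg; near=> x; rewrite mean_logdetE.
Unshelve. all: by end_near. Qed.

Lemma mean_logdet_cvgy : mean_logdet n x @[x --> +oo] --> (0 : R).
Proof.
apply: cvg_trans (@cvg_mean_formula_pinfty R k).
by apply: near_eq_cvg; near=> x; rewrite mean_logdetE.
Unshelve. all: by end_near. Qed.

Lemma mean_logdet_surj (y : R) : y < 0 ->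
  exists! eta : R, 0 < eta /\ mean_logdet n eta = y.
Proof.
move=> y0.
have [a [a0 ay]] : exists a : R, 0 < a /\ mean_logdet n a <= y.
  have /cvgrNyPle/(_ y) H := mean_logdet_cvg0.
  have : \forall x \near (0 : R)^'+, 0 < x /\ mean_logdet n x <= y.
    by near=> x; split => //; near: x; exact: H.
  by move=> /filter_ex.
have [b [ab yb]] : exists b : R, a < b /\ y <= mean_logdet n b.
  have H := cvgr_gt _ mean_logdet_cvgy _ y0.
  have : \forall x \near +oo, a < x /\ y <= mean_logdet n x.
    near=> x; split; first by near: x; apply: nbhs_pinfty_gt; rewrite num_real.
    by apply: ltW; near: x; exact: H.
  by move=> /filter_ex.
have cab : {within `[a, b], continuous (@mean_logdet R n)}.
  apply: continuous_subspaceW mean_logdet_continuous => x /=.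
  by rewrite !in_itv/= andbT => /andP[ax _]; exact: lt_le_trans ax.
have yI : Num.min (mean_logdet n a) (mean_logdet n b) <= y <=
    Num.max (mean_logdet n a) (mean_logdet n b).
  by rewrite ge_min ay/= le_max yb orbT.
have [c] := IVT (ltW ab) cab yI.
rewrite in_itv/= => /andP[ac _] cy.
have c0 : 0 < c by exact: lt_le_trans ac.
exists c; split=> // c' [c'0 c'y].
have [h|h|//] := ltgtP c c'.
- have := @mean_logdet_lt c c'; rewrite !in_itv/= !andbT => /(_ c0 c'0 h).
  by rewrite cy c'y ltxx.
- have := @mean_logdet_lt c' c; rewrite !in_itv/= !andbT => /(_ c'0 c0 h).
  by rewrite cy c'y ltxx.
Unshelve. all: by end_near. Qed.

Lemma LKJ1_uniform A : measurable A -> LKJ n 1 A = @uniform_elliptope R n A.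
Proof.
move=> mA; have mE := @measurable_elliptope_coord R n.
have w B : measurable B -> lkj_weight 1 B = lam (B `&` @elliptope_coord R n).
  move=> mB; have mBE := measurableI _ _ mB mE.
  rewrite /lkj_weight (eq_integral (cst 1%E)).
    by rewrite integral_cst// mul1e.
  by move=> x _; rewrite subrr powRr0.
rewrite LKJ_weight// /uniform_elliptope w//; congr (_ * (_^-1)%:E)%E.
have := w _ (@measurableT _ (Rtuple R (offdiag_dim n))); rewrite setTI => <-.
by rewrite /lkj_weight setTI -/(lkj_Z n 1) lkj_ZE.
Qed.

End conclusions.

Theorem proposition3 (R : realType) (n : nat) (hn : (2 <= n)%N) :
  (* LKJ and the entropy are well defined *)
  (forall eta : R, 0 < eta ->
     (0 < lkj_Z n eta < +oo)%E /\ is_density (LKJ n eta) (lkj_density eta)) /\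
  (forall (P : probability (Rtuple R (offdiag_dim n)) R)
          (f : Rtuple R (offdiag_dim n) -> R),
     elliptope_probs P -> is_density P f ->
     entropy P = (- \int[lebesgue_tuple R (offdiag_dim n)]_(x in @elliptope_coord R n)
                      (f x * ln (f x))%:E)%E /\
     entropy P = (- 'E_P[fun x => ln (f x)])%E) /\
  (* the formula for m *)
  (forall eta : R, 0 < eta ->
     ('E_(LKJ n eta)[@logdet R n] = (mean_logdet n eta)%:E)%E /\
     mean_logdet n eta =
       \sum_(0 <= j < n) digamma (eta + j%:R / 2)
         - n%:R * digamma (eta + (n.-1)%:R / 2)) /\
  (* (i) *)
  (forall eta : R, 0 < eta ->
     unique_maximizer (@entropy R n)
       [set P | elliptope_probs P /\ ('E_P[@logdet R n] = (mean_logdet n eta)%:E)%E]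
       (LKJ n eta)) /\
  (* (ii) *)
  ({within `]0, +oo[, continuous (@mean_logdet R n)} /\
   {in `]0, +oo[ &, {homo (@mean_logdet R n) : x y / x < y}} /\
   mean_logdet n x @[x --> (0 : R)^'+] --> -oo /\
   mean_logdet n x @[x --> +oo] --> (0 : R) /\
   (forall y : R, y < 0 -> exists! eta : R, 0 < eta /\ mean_logdet n eta = y)) /\
  (* (iii) *)
  ((forall A, measurable A -> LKJ n 1 A = @uniform_elliptope R n A) /\
   unique_maximizer (@entropy R n) (@elliptope_probs R n) (LKJ n 1)).
Proof.
case: n hn => [|[|k]]// _.
split=> [eta eta0|].
  split; last exact: LKJ_density.
  by rewrite lkj_ZE// lte_fin lkj_const_gt0// ltry.
split=> [P f PE dP|].
  by split; [exact: entropyE|exact: entropy_expectation].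
split=> [eta eta0|].
  by rewrite LKJ_mean// mean_logdetE.
split=> [eta eta0|].
  apply: (unique_maximizer_LKJ (m := mean_logdet k.+2 eta)) => //.
  - by move=> Q [].
  - by split; [exact: LKJ_elliptope|rewrite LKJ_mean// mean_logdetE].
  - by move=> Q [_ Qm]; exact: integral_scaled_logdet.
split.
  split; first exact: mean_logdet_continuous.
  split; first exact: mean_logdet_lt.
  split; first exact: mean_logdet_cvg0.
  split; first exact: mean_logdet_cvgy.
  exact: mean_logdet_surj.
split; first exact: LKJ1_uniform.
apply: (unique_maximizer_LKJ (m := 0)) => //; first exact: LKJ_elliptope.
move=> Q _; rewrite integral0_eq ?mulr0// => x _.
by rewrite subrr mul0r.
Qed.
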